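(* Let $\ell\ge1$ and $n$ be integers with $n\ge 6\ell+11$, and let $T$ be an $n$-vertex tree whose longest path has $r$ vertices, where $r\ge n-3\ell$. If $T$ contains no subgraph isomorphic to the spider $S_{\ell+1,\ell+1,\ell+1}$, then $T$ is $\ell$-reconstructible.
   Context: The $(n-\ell)$-deck of an $n$-vertex graph is the multiset of its (unlabeled) induced subgraphs on $n-\ell$ vertices. An $n$-vertex graph is $\ell$-reconstructible if every graph with the same $(n-\ell)$-deck is isomorphic to it. The spider $S_{j_1,\dots,j_d}$ is the tree formed by $d$ paths of lengths $j_1,\dots,j_d$ (length = number of edges) that share one common endpoint and are otherwise disjoint. *)

(* Defs.v *)
From mathcomp Require Import all_boot.

Set Implicit Arguments.
Unset Strict Implicit.
Unset Printing Implicit Defensive.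

Record sgraph := SGraph {
  vertex :> finType;
  edge : rel vertex;
  edge_sym : symmetric edge;
  edge_irr : irreflexive edge }.

Definition iso (G H : sgraph) : Prop :=
  exists2 f : G -> H, bijective f & {mono f : x y / edge x y}.

(* Boolean form of [iso], so that the induced subgraphs in a given isomorphism
   class can be counted. *)
Definition isob (G H : sgraph) : bool :=
  [exists f : {ffun G -> H},
    [&& injectiveb f, [forall y, y \in codom f] &
        [forall x, forall y, edge (f x) (f y) == edge x y]]].

Lemma isoP (G H : sgraph) : reflect (iso G H) (isob G H).
Proof.
apply: (iffP existsP) => [[f /and3P [/injectiveP fI /forallP fS /forallP fE]]|].
  exists f; last by move=> x y; exact/eqP/(forallP (fE x)).
  exists (fun y => iinv (fS y)) => [x|y]; last exact: f_iinv.
  by apply: fI; rewrite f_iinv.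
case=> f [g fK gK] fE; exists (finfun f); apply/and3P; split.
- by apply/injectiveP => x y; rewrite !ffunE => /(can_inj fK).
- by apply/forallP => y; apply/codomP; exists (g y); rewrite ffunE gK.
- by apply/forallP => x; apply/forallP => y; rewrite !ffunE fE.
Qed.

Section Induced.
Variables (G : sgraph) (A : {set G}).

Definition induced_edge : rel {x : G | x \in A} :=
  fun u v => edge (val u) (val v).

Lemma induced_sym : symmetric induced_edge.
Proof. by move=> u v; exact: edge_sym. Qed.

Lemma induced_irr : irreflexive induced_edge.
Proof. by move=> u; exact: edge_irr. Qed.

Definition induced : sgraph := SGraph induced_sym induced_irr.
End Induced.

(* The k-deck as a multiset of unlabeled graphs: [deck G k F] is the
   multiplicity in it of the isomorphism class of [F]. *)
Definition deck (G : sgraph) (k : nat) (F : sgraph) : nat :=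
  #|[set A : {set G} | (#|A| == k) && isob (induced A) F]|.

Definition reconstructible (l : nat) (G : sgraph) : Prop :=
  forall H : sgraph, deck H (#|G| - l) =1 deck G (#|G| - l) -> iso H G.

Definition connected (G : sgraph) : Prop :=
  0 < #|G| /\ forall x y : G, connect (@edge G) x y.

(* [ucycle] also accepts the degenerate closed walks on at most two vertices,
   which are not graph cycles. *)
Definition acyclic (G : sgraph) : Prop :=
  forall c : seq G, 2 < size c -> ~ ucycle (@edge G) c.

Definition is_tree (G : sgraph) : Prop := connected G /\ acyclic G.

Definition is_path (G : sgraph) (s : seq G) : bool :=
  sorted (@edge G) s && uniq s.

Definition longest_path_order (G : sgraph) (r : nat) : Prop :=
  (exists2 s : seq G, is_path s & size s = r) /\
  (forall s : seq G, is_path s -> size s <= r).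

(* Subgraphs need not be induced. *)
Definition contains (F G : sgraph) : Prop :=
  exists2 f : F -> G, injective f & {homo f : x y / edge x y}.

Section Spider.
Variable js : seq nat.

(* [None] is the common endpoint of the legs; [Some (Tagged _ k)], with tag [i],
   is the vertex at distance [k.+1] from it on the leg of length [nth 0 js i]. *)
Definition spider_vertex : finType :=
  option {i : 'I_(size js) & 'I_(nth 0 js i)}.

Definition spider_step (u v : spider_vertex) : bool :=
  match u, v with
  | None, Some q => tagged q == 0 :> nat
  | Some p, Some q => (tag p == tag q) && (tagged q == (tagged p).+1 :> nat)
  | _, None => false
  end.

Definition spider_edge : rel spider_vertex :=
  fun u v => spider_step u v || spider_step v u.

Lemma spider_sym : symmetric spider_edge.
Proof. by move=> u v; rewrite /spider_edge orbC. Qed.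

Lemma spider_irr : irreflexive spider_edge.
Proof. by case=> [p|] //; rewrite /spider_edge /= orbb ltn_eqF ?andbF. Qed.

Definition spider : sgraph := SGraph spider_sym spider_irr.
End Spider.

(* Main.v *)
(* A graph with the same (n-l)-deck as T contains every graph on at most
   k = n-l vertices as often as T does (Kelly), and this makes it a tree H: a
   cycle on at most k vertices would also occur in T, and a longer one would
   give H more paths on at most k vertices than the n(n-1)/2 pairs of vertices of
   T allow.  As T has no long-legged spider, neither has H, so both trees are a
   "spine" (the longest path without l vertices at both ends) with a rooted tree
   of height at most l, a "letter", hanging on each of its vertices; it remains
   to compare the two words of letters.

   Windows: for a spine segment [a..b], the l-neighbourhood of [a..b] is the only
   maximal subtree around (a, b), so the multiset of windows of a fixed length is
   determined by the subtree counts (by downward induction on size), as long as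
   all windows of that length have fewer than k vertices.  Dropping the last
   spine vertex of the windows of length D+1, read in both directions, yields
   all windows of length D except those at the two ends of the spine.  So H has
   the same end windows as T, with the same orientation.  If the spine has at
   least 2l+5 edges the two end windows show all letters and T and H agree.

   Otherwise n-r >= 2l+6, and k-vertex subtrees can contain a longest path and
   at least l+2 further vertices.  Counting subtrees that consist of a longest
   path and part of one letter shows that each pair of mirror letters is the same
   in T and H up to a swap; a letter too large for this is found together with
   a short piece of the path.  Two pairs cannot be arranged inconsistently,
   because the smaller letters of two asymmetric pairs have at most (n-r)/2
   vertices off the path in total, so that a witness of their relative
   orientation is again visible in a k-vertex subtree. *)

Require Import Defs.
From mathcomp Require Import all_boot zify.

Set Implicit Arguments.
Unset Strict Implicit.
Unset Printing Implicit Defensive.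

(** * Counting subgraphs *)

Lemma split_pos (X : Type) (s : seq X) (F : X -> nat) :
  0 < \sum_(y <- s) F y -> exists s1 y s2, s = s1 ++ y :: s2 /\ 0 < F y.
Proof.
elim: s => [|y s IH]; first by rewrite big_nil.
rewrite big_cons; case: (posnP (F y)) => [->|Fy _].
  by rewrite add0n => /IH [s1 [z [s2 [-> Fz]]]]; exists (y :: s1), z, s2.
by exists [::], y, s.
Qed.

Lemma count_sum (X : Type) (s : seq X) (a : pred X) :
  count a s = \sum_(y <- s) a y.
Proof. by elim: s => [|y s IH]; rewrite ?big_nil // big_cons /= IH. Qed.

(** Graphs are compared only up to a relation [R], so multisets of classes are handled as lists. The
    first entry of [s] is cancelled against a related entry of [t]. *)
Lemma sum_eq_count (X : Type) (R : rel X) (s t : seq X) (phi : X -> nat) :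
    (forall x, R x x) -> (forall x y z, R x y -> R x z = R y z) ->
    (forall x y, R x y -> phi x = phi y) ->
    (forall z, count (R^~ z) s = count (R^~ z) t) ->
  \sum_(x <- s) phi x = \sum_(x <- t) phi x.
Proof.
move=> Rxx Rt phiR; elim: s t => [|x s IH] t st.
  by case: t st => [|y t] // /(_ y) /=; rewrite Rxx.
have: 0 < count (R^~ x) t by rewrite -st /= Rxx.
rewrite count_sum => /split_pos [t1 [y [t2 [tE Ryx]]]].
have {}Ryx : R y x by move: Ryx; case: (R y x).
rewrite tE big_cat !big_cons /= (phiR _ _ Ryx).
rewrite (IH (t1 ++ t2)) ?big_cat /=; first by lia.
move=> z; have := st z; rewrite tE !count_cat /= (Rt _ _ z Ryx); lia.
Qed.

(** Labelled copies: each subgraph of [G] isomorphic to [F] is counted once per automorphism of [F],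
    which avoids any quotient. *)
Definition homs (F G : sgraph) : {set {ffun F -> G}} :=
  [set f : {ffun F -> G} | injectiveb f &
     [forall x, forall y, edge x y ==> edge (f x) (f y)]].

Lemma homsP (F G : sgraph) (f : {ffun F -> G}) :
  reflect (injective f /\ {homo f : x y / edge x y}) (f \in homs F G).
Proof.
rewrite inE; apply: (iffP andP) => [[/injectiveP fI /forallP fE]|[fI fE]].
  by split=> // x y xy; have /forallP/(_ y)/implyP := fE x; apply.
split; first exact/injectiveP.
by apply/forallP => x; apply/forallP => y; apply/implyP; apply: fE.
Qed.

Lemma homs_comp_le (F G K : sgraph) (h : G -> K) :
  injective h -> {homo h : x y / edge x y} -> #|homs F G| <= #|homs F K|.
Proof.
move=> hI hE; pose c (f : {ffun F -> G}) := [ffun x => h (f x)] : {ffun F -> K}.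
have cI : injective c.
  move=> f g /ffunP fg; apply/ffunP => x; apply: hI.
  by have := fg x; rewrite !ffunE.
rewrite -(card_imset _ cI); apply/subset_leq_card/subsetP => _ /imsetP[f /homsP[fI fE] ->].
by apply/homsP; split=> [x y|x y xy]; rewrite !ffunE ?hE ?fE // => /hI/fI.
Qed.

Lemma homs_iso (F G K : sgraph) : iso G K -> #|homs F G| = #|homs F K|.
Proof.
case=> f [g fK gK] fE; apply/eqP; rewrite eqn_leq.
rewrite (homs_comp_le _ (can_inj fK)) => [|x y]; last by rewrite fE.
by rewrite (homs_comp_le _ (can_inj gK)) // => x y; rewrite -fE !gK.
Qed.

Lemma homs_induced (F G : sgraph) (A : {set G}) :
  #|homs F (induced A)| = #|[set f in homs F G | [forall x, f x \in A]]|.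
Proof.
pose c (f : {ffun F -> induced A}) := [ffun x => val (f x)] : {ffun F -> G}.
have cI : injective c.
  move=> f g /ffunP fg; apply/ffunP => x; apply: val_inj.
  by have := fg x; rewrite !ffunE.
rewrite -(card_imset _ cI); apply: eq_card => f; rewrite inE.
apply/imsetP/andP => [[g /homsP[gI gE] ->]|[/homsP[fI fE] /forallP fA]].
  split; last by apply/forallP => x; rewrite ffunE (valP (g x)).
  by apply/homsP; split=> [x y|x y /gE]; rewrite !ffunE // => /val_inj/gI.
exists [ffun x => exist _ (f x) (fA x) : induced A].
  apply/homsP; split=> [x y|x y xy]; rewrite !ffunE.
    by move=> [/fI].
  exact: fE.
by apply/ffunP => x; rewrite !ffunE.
Qed.

Lemma card_supersets (T : finType) (B : {set T}) (k : nat) : #|B| <= k ->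
  #|[set A : {set T} | (B \subset A) && (#|A| == k)]| = 'C(#|T| - #|B|, k - #|B|).
Proof.
move=> Bk; have <- : #|~: B| = #|T| - #|B| by rewrite -(cardsC B) addKn.
rewrite -cards_draws.
have K (A : {set T}) : A \subset ~: B -> (A :|: B) :\: B = A.
  by rewrite -disjoints_subset setDUl setDv setU0 => /setDidPl.
have cI : {in [set A : {set T} | A \subset ~: B & #|A| == k - #|B|] &,
    injective (fun A => A :|: B)}.
  by move=> A A'; rewrite !inE => /andP[/K AB _] /andP[/K AB' _] E; rewrite -AB E.
rewrite -(card_in_imset cI); apply: eq_card => A; rewrite !inE.
apply/andP/imsetP => [[BA /eqP Ak]|[A']].
  exists (A :\: B); last by rewrite setUC -{1}(setID A B) (setIidPr BA).
  rewrite inE cardsD (setIidPr BA) Ak eqxx andbT.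
  by apply/subsetP => x; rewrite !inE => /andP[].
rewrite inE -disjoints_subset => /andP[dis /eqP A'k] ->.
split; first exact: subsetUr.
by rewrite cardsU A'k disjoint_setI0 // cards0 subn0 subnK.
Qed.

(** Double counting of the pairs of a copy [f] and a [k]-set containing its image; the image has
    [#|F|] vertices, so the number of such [k]-sets does not depend on [f]. *)
Lemma kelly (F G : sgraph) (k : nat) : #|F| <= k ->
  \sum_(A : {set G} | #|A| == k) #|homs F (induced A)| =
  #|homs F G| * 'C(#|G| - #|F|, k - #|F|).
Proof.
move=> Fk.
under eq_bigr => A _ do rewrite homs_induced -sum1_card.
under eq_bigr => A _ do under eq_bigl => f do rewrite inE.
rewrite (exchange_big_dep (mem (homs F G))) /=; last by move=> A f _ /andP[].
rewrite -sum_nat_const; apply: eq_bigr => f /homsP[fI fE].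
have <- : #|f @: setT| = #|F| by rewrite card_imset // cardsT.
rewrite sum1dep_card -card_supersets ?card_imset ?cardsT //.
have fH : f \in homs F G by apply/homsP.
apply: eq_card => A; rewrite !inE andbC; congr andb.
move: fH; rewrite inE => -> /=.
apply/forallP/subsetP => [fA _ /imsetP[x _ ->] //|fA x].
by apply: fA; apply: imset_f.
Qed.

Lemma isob_trans_eq (X Y Z : sgraph) : isob X Y -> isob X Z = isob Y Z.
Proof.
move=> /isoP [f [g fK gK] fE].
apply/isoP/isoP => [[h [h' hK h'K] hE]|[h [h' hK h'K] hE]].
  exists (h \o g); first by exists (f \o h') => x /=; rewrite ?hK ?gK ?fK ?h'K.
  by move=> x y /=; rewrite hE -fE !gK.
exists (h \o f); first by exists (g \o h') => x /=; rewrite ?hK ?gK ?fK ?h'K.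
by move=> x y /=; rewrite hE fE.
Qed.

Lemma isob_refl (X : sgraph) : isob X X.
Proof. by apply/isoP; exists id => //; exists id. Qed.

(** The sum is taken over the list of induced subgraphs, where the class of [F] occurs [deck K k F]
    times. *)
Lemma deck_sum (G H : sgraph) (k : nat) (phi : sgraph -> nat) :
    (forall X Y, iso X Y -> phi X = phi Y) -> deck H k =1 deck G k ->
  \sum_(A : {set H} | #|A| == k) phi (induced A) =
  \sum_(A : {set G} | #|A| == k) phi (induced A).
Proof.
move=> phi_iso HG.
have flat (K : sgraph) (psi : sgraph -> nat) :
    \sum_(A : {set K} | #|A| == k) psi (induced A) =
    \sum_(X <- [seq induced A | A <- enum [set A : {set K} | #|A| == k]]) psi X.
  by rewrite big_map big_enum_cond /=; apply: eq_bigl => A; rewrite inE andbT.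
rewrite !flat; apply: (@sum_eq_count _ isob) => [X|X Y Z|X Y /isoP|F].
- exact: isob_refl.
- exact: isob_trans_eq.
- exact: phi_iso.
have cnt (K : sgraph) :
    count (isob^~ F) [seq induced A | A <- enum [set A : {set K} | #|A| == k]] = deck K k F.
  rewrite count_map -sum1_count big_enum_cond /= /deck sum1dep_card.
  by apply: eq_card => A; rewrite !inE.
by rewrite !cnt.
Qed.

Lemma bin_inj_l (m n k : nat) : 0 < k <= n -> 'C(m, k) = 'C(n, k) -> m = n.
Proof.
have lt a b j : 0 < j <= b -> a < b -> 'C(a, j) < 'C(b, j).
  case: j b => [|j] [|b] // jb ab; rewrite binS.
  by apply: (leq_ltn_trans (leq_bin2l _ (ab : a <= b))); rewrite -[X in X < _]addn0 ltn_add2l bin_gt0.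
move=> kn E; case: (ltngtP m n) => // [mn|nm].
  by have := lt _ _ _ kn mn; rewrite E ltnn.
have kn' : 0 < k <= m by move: kn nm; lia.
by have := lt _ _ _ kn' nm; rewrite E ltnn.
Qed.

Lemma deck_card (G H : sgraph) (k : nat) :
  0 < k <= #|G| -> deck H k =1 deck G k -> #|H| = #|G|.
Proof.
move=> kG /(@deck_sum _ _ _ (fun=> 1) (fun _ _ _ => erefl)).
rewrite !sum1dep_card.
have cd (K : sgraph) : #|[set A : {set K} | #|A| == k]| = 'C(#|K|, k).
  by rewrite -cardsT -cards_draws; apply: eq_card => A; rewrite !inE subsetT.
by rewrite !cd => /bin_inj_l; apply.
Qed.

(** The binomial factor in Kelly's count depends only on the orders, which agree, and is positive;
    hence it cancels. *)
Lemma deck_homs (G H F : sgraph) (k : nat) :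
    #|H| = #|G| -> #|F| <= k <= #|G| -> deck H k =1 deck G k ->
  #|homs F H| = #|homs F G|.
Proof.
move=> HG /andP[Fk kG] /(deck_sum (@homs_iso F)).
rewrite !kelly // HG => /eqP; rewrite eqn_pmul2r; first by move/eqP.
by rewrite bin_gt0; lia.
Qed.

(** * Distance *)

Section Dist.
Variable G : sgraph.
Implicit Types (x y z w a b : G) (p q : seq G).

Fixpoint walk n x y : bool :=
  if n is n'.+1 then [exists z, edge x z && walk n' z y] else x == y.

(* Junk value: [dist x y = #|G|] when [y] is not reachable from [x]. *)
Definition dist x y : nat := find (fun n => walk n x y) (iota 0 #|G|).

Lemma walkP n x y :
  reflect (exists p, [/\ path (@edge G) x p, last x p = y & size p = n]) (walk n x y).
Proof.
elim: n x => [|n IH] x /=.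
  by apply: (iffP eqP) => [->|[p [_ + /size0nil pE]]]; [exists [::]|rewrite pE].
apply: (iffP existsP) => [[z /andP[xz /IH[p [pp pl ps]]]]|[[|z p] [] //= /andP[xz pp] pl [ps]]].
  by exists (z :: p); rewrite /= xz pp ps.
by exists z; rewrite xz; apply/IH; exists p.
Qed.

Lemma connect_walk x y : connect (@edge G) x y -> exists2 n, n < #|G| & walk n x y.
Proof.
case/connectP => p pp ->; case/shortenP: pp => q pq uq _.
exists (size q); last by apply/walkP; exists q.
by have := max_card (mem (x :: q)); rewrite (card_uniqP uq).
Qed.

Lemma dist_walk x y : connect (@edge G) x y -> walk (dist x y) x y.
Proof.
case/connect_walk => n nG wn.
have h : has (fun m => walk m x y) (iota 0 #|G|).
  by apply/hasP; exists n; rewrite // mem_iota.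
by have := nth_find 0 h; rewrite nth_iota ?add0n // -[X in _ < X](size_iota 0) -has_find.
Qed.

Lemma dist_le n x y : walk n x y -> dist x y <= n.
Proof.
move=> wn; rewrite leqNgt; apply/negP => lt.
have nG : n < #|G|.
  by rewrite -[X in _ < X](size_iota 0); apply: (leq_trans lt); apply: find_size.
by have := before_find 0 lt; rewrite nth_iota // add0n wn.
Qed.

Lemma dist0 x y : connect (@edge G) x y -> (dist x y == 0) = (x == y).
Proof.
move=> /dist_walk; case E: (dist x y) => [|n] /=; first by move=> ->.
move=> _; apply/esym/negP => xy; have := @dist_le 0 x y xy; by rewrite E.
Qed.

Lemma distxx x : dist x x = 0.
Proof. by apply/eqP; rewrite -leqn0; apply: dist_le => /=. Qed.

Lemma walk_sym n x y : walk n x y -> walk n y x.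
Proof.
case/walkP => p [pp <- ps]; apply/walkP; exists (rev (belast x p)).
rewrite size_rev size_belast ps; split=> //.
  by rewrite rev_path; under eq_path do rewrite edge_sym.
by case: p {pp ps} => //= z p; rewrite rev_cons last_rcons.
Qed.

Lemma walk_cat m n x y z : walk m x y -> walk n y z -> walk (m + n) x z.
Proof.
case/walkP => p [pp pl <-] /walkP [q [qq ql <-]]; apply/walkP; exists (p ++ q).
by rewrite cat_path last_cat pp pl qq size_cat.
Qed.

Lemma connect_symG : connect_sym (@edge G).
Proof. by apply: sym_connect_sym => x y; exact: edge_sym. Qed.

Lemma dist_sym x y : connect (@edge G) x y -> dist x y = dist y x.
Proof.
move=> c; have c' : connect (@edge G) y x by rewrite connect_symG.
by apply/eqP; rewrite eqn_leq; apply/andP; split; apply/dist_le/walk_sym/dist_walk.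
Qed.

Lemma dist_tri y x z : connect (@edge G) x y -> connect (@edge G) y z ->
  dist x z <= dist x y + dist y z.
Proof. by move=> xy yz; apply/dist_le/walk_cat; apply: dist_walk; eauto. Qed.

Lemma geodesic x y : connect (@edge G) x y ->
  exists p, [/\ path (@edge G) x p, last x p = y, size p = dist x y, uniq (x :: p) &
    forall z, z \in x :: p -> dist x z + dist z y = dist x y].
Proof.
move=> c; have /walkP [p0 [pp0 pl0 ps0]] := dist_walk c.
have [p [pp pl ps up]] : exists p, [/\ path (@edge G) x p, last x p = y,
    size p = dist x y & uniq (x :: p)].
  case/shortenP: pp0 pl0 ps0 => q pq uq sq lq sp; exists q; split=> //.
  apply/eqP; rewrite eqn_leq -{1}sp dist_le ?andbT; last by apply/walkP; exists q.
  by apply: uniq_leq_size => // ; case/andP: uq.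
exists p; split=> // z; rewrite inE => /predU1P [->|zp]; first by rewrite distxx.
case/splitPr: zp pp pl ps {up} => p1 p2.
rewrite -cat_rcons cat_path last_cat last_rcons size_cat => /andP[pp1 pp2] pl ps.
have [n1 [n2 [E w1 w2]]] : exists n1 n2, [/\ n1 + n2 = dist x y, walk n1 x z & walk n2 z y].
  exists (size (rcons p1 z)), (size p2); split; first exact: ps.
    by apply/walkP; exists (rcons p1 z); rewrite last_rcons.
  by apply/walkP; exists p2.
have := dist_le w1; have := dist_le w2.
have c1 : connect (@edge G) x z by apply/connectP; exists (rcons p1 z); rewrite ?last_rcons.
have c2 : connect (@edge G) z y by apply/connectP; exists p2.
have := dist_tri c1 c2; lia.
Qed.

Lemma dist_step x y : connect (@edge G) x y -> x != y ->
  exists z, [/\ edge z y, connect (@edge G) x z & dist x y = (dist x z).+1].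
Proof.
move=> c xy; have [p [pp pl ps _ add]] := geodesic c.
case/lastP: p => [|p z] in pp pl ps add *; first by rewrite /= in pl; rewrite pl eqxx in xy.
move: pp pl ps; rewrite rcons_path last_rcons size_rcons => /andP[pp e] zy ps.
rewrite zy in e add ps *.
exists (last x p); split=> //; first by apply/connectP; exists p.
have w : walk (size p) x (last x p) by apply/walkP; exists p.
have w1 : walk 1 (last x p) y by apply/walkP; exists [:: y]; rewrite /= e.
have cc : connect (@edge G) x (last x p) by apply/connectP; exists p.
by have := dist_le w; have := dist_le (walk_cat (dist_walk cc) w1); lia.
Qed.

End Dist.

Section Acyclic.
Variable G : sgraph.
Hypothesis Gac : acyclic G.
Implicit Types (x y z w a b : G) (p q : seq G).

(** Where the paths diverge, follow the first one up to the first vertex [w] on the second, then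
    return along the second: this closes a cycle on at least three vertices. *)
Lemma uniq_path_unique x p q :
    path (@edge G) x p -> path (@edge G) x q -> uniq (x :: p) -> uniq (x :: q) ->
  last x p = last x q -> p = q.
Proof.
elim: p x q => [|y p IH] x [|z q] //.
- by move=> _ _ _ /= /andP[nx _] E; rewrite E mem_last in nx.
- by move=> _ _ /= /andP[nx _] _ E; rewrite -E mem_last in nx.
have [<-|yz] := eqVneq y z.
  move=> /= /andP[_ pp] /andP[_ qq] /andP[_ up] /andP[_ uq] E; congr cons; exact: IH pp qq up uq E.
set P := y :: p; set Q := z :: q => pp qq up uq E; exfalso.
have hP : has (mem Q) P.
  by apply/hasP; exists (last y p); [exact: mem_last|rewrite /= in E; rewrite E; exact: mem_last].
have [w wQ [p1 [p2 [PE nQ]]]] : exists2 w, w \in Q & exists p1 p2, P = p1 ++ w :: p2 /\ ~~ has (mem Q) p1.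
  move: hP; case/split_find => w p1 p2 wQ nQ; exists w => //.
  by exists p1, p2; rewrite cat_rcons.
have [q1 [q2 QE]] : exists q1 q2, Q = q1 ++ w :: q2 by case/splitPr: wQ => q1 q2; exists q1, q2.
apply: (Gac (c := x :: p1 ++ w :: rev q1)).
  case: p1 PE {nQ} => [|? p1] PE; last by rewrite /= size_cat /=; lia.
  case: q1 QE => [|? q1] QE; last by rewrite /= size_rev /=; lia.
  by case: PE QE => yw _ [zw _]; rewrite yw zw eqxx in yz.
rewrite /ucycle; apply/andP; split.
  rewrite /= rcons_cat rcons_cons cat_path.
  move: pp; rewrite PE cat_path /= => /and3P[-> -> _] /=.
  move: qq; rewrite QE -cat_rcons cat_path => /andP[qq _].
  have := rev_path (@edge G) x (rcons q1 w); rewrite last_rcons belast_rcons rev_cons => ->.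
  by rewrite (eq_path (e' := @edge G)) // => a b; rewrite edge_sym.
move: up uq; rewrite PE QE !cons_uniq !mem_cat !inE !cat_uniq !cons_uniq /= !negb_or mem_rev.
move=> /and3P[/and3P[-> -> _] -> /and3P[/andP[wp1 _] _ _]].
move=> /and3P[/and3P[-> _ _] uq1 /and3P[/andP[wq1 _] _ _]] /=.
rewrite mem_rev rev_uniq wq1 uq1 wp1 /= andbT.
apply/hasPn => a; rewrite mem_rev => aq1; apply/negP => ap1.
by move/hasPn: nQ => /(_ a ap1); rewrite inE QE mem_cat aq1.
Qed.

Lemma path_dist x p : path (@edge G) x p -> uniq (x :: p) -> dist x (last x p) = size p.
Proof.
move=> pp up; have c : connect (@edge G) x (last x p) by apply/connectP; exists p.
have [q [qq ql qs uq _]] := geodesic c.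
by rewrite -qs (uniq_path_unique qq pp uq up ql).
Qed.

(** If both ends of the edge were equally far from [x], a geodesic to [y] prolonged by [z] would be
    a path to [z] that is longer than the distance. *)
Lemma dist_edge x y z : connect (@edge G) x y -> edge y z ->
  dist x z = (dist x y).+1 \/ dist x y = (dist x z).+1.
Proof.
move=> c yz.
have cyz : connect (@edge G) y z by exact: connect1.
have czy : connect (@edge G) z y by rewrite connect_symG.
have cxz := connect_trans c cyz.
have w1 : dist y z <= 1 by apply: dist_le; apply/walkP; exists [:: z]; rewrite /= yz.
have w2 : dist z y <= 1.
  by apply: dist_le; apply/walkP; exists [:: y]; rewrite /= edge_sym yz.
have := dist_tri c cyz; have := dist_tri cxz czy => t1 t2.
suff : dist x y <> dist x z by lia.
move=> E; have [p [pp pl ps up add]] := geodesic c.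
have zp : z \notin x :: p.
  apply/negP => /add; rewrite -E => d0.
  have zy : z == y by rewrite -(dist0 czy); apply/eqP; lia.
  by move: yz; rewrite (eqP zy) edge_irr.
have pz : path (@edge G) x (rcons p z) by rewrite rcons_path pp pl.
have uz : uniq (x :: rcons p z) by rewrite -rcons_cons rcons_uniq zp up.
by have := path_dist pz uz; rewrite last_rcons size_rcons; lia.
Qed.

Lemma closer_unique x y z1 z2 : connect (@edge G) x y -> edge y z1 -> edge y z2 ->
  dist x y = (dist x z1).+1 -> dist x y = (dist x z2).+1 -> z1 = z2.
Proof.
move=> c e1 e2 d1 d2.
have ext z : edge y z -> dist x y = (dist x z).+1 ->
    exists p, [/\ path (@edge G) x (rcons p y), uniq (x :: rcons p y) & last x p = z].
  move=> e d; have cz : connect (@edge G) x z := connect_trans c (connect1 e).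
  have [p [pp pl ps up add]] := geodesic cz; exists p; split=> //.
    by rewrite rcons_path pp pl edge_sym.
  rewrite -rcons_cons rcons_uniq up andbT; apply/negP => /add; lia.
have [p1 [pp1 u1 l1]] := ext _ e1 d1; have [p2 [pp2 u2 l2]] := ext _ e2 d2.
have := uniq_path_unique pp1 pp2 u1 u2; rewrite !last_rcons => /(_ erefl) /rcons_inj [pE].
by rewrite -l1 -l2 pE.
Qed.
End Acyclic.

(** * Geometry of trees *)

(* [S] contains, with each of its vertices, the whole geodesic to [a]. *)
Definition star (G : sgraph) (a : G) (S : {set G}) : Prop :=
  a \in S /\ forall x, x \in S -> x != a ->
    exists y, [/\ y \in S, edge y x & dist a x = (dist a y).+1].

Section TreeMetric.
Variable G : sgraph.
Hypothesis Gt : is_tree G.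
Implicit Types (x y z w a b u : G) (S : {set G}).
Local Notation d := (@dist G).

Let Gc x y : connect (@edge G) x y := Gt.1.2 x y.
Let Ga : acyclic G := Gt.2.

Lemma dC x y : d x y = d y x. Proof. exact: dist_sym. Qed.
Lemma dT y x z : d x z <= d x y + d y z. Proof. exact: dist_tri. Qed.
Lemma dP x y : (d x y == 0) = (x == y). Proof. exact: dist0. Qed.
Lemma d0_eq x y : d x y = 0 -> x = y. Proof. by move/eqP; rewrite dP => /eqP. Qed.

Lemma d_edge x y z : edge y z -> d x z = (d x y).+1 \/ d x y = (d x z).+1.
Proof. exact: dist_edge. Qed.

Lemma d1 x y : (d x y == 1) = edge x y.
Proof.
apply/eqP/idP => [E|e].
  have xy : x != y by rewrite -dP E.
  by have [z [e _ dz]] := dist_step (Gc x y) xy; have -> : x = z by apply: d0_eq; lia.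
by have := d_edge x e; rewrite distxx; lia.
Qed.

Lemma d_step x y : x != y -> exists z, edge z y /\ d x y = (d x z).+1.
Proof. by move=> /(dist_step (Gc x y)) [z [e _ dz]]; exists z. Qed.

Lemma d_closer x y z1 z2 : edge y z1 -> edge y z2 ->
  d x y = (d x z1).+1 -> d x y = (d x z2).+1 -> z1 = z2.
Proof. exact: closer_unique. Qed.

Lemma point x y i : i <= d x y -> exists z, d x z = i /\ d z y = d x y - i.
Proof.
move: {2}(d x y - i) (erefl (d x y - i)) => j; elim: j y => [|j IH] y ji iy.
  by exists y; rewrite distxx; lia.
have xy : x != y by rewrite -dP; lia.
have [u [e du]] := d_step xy.
have [||z [xz zu]] := IH u; try lia.
by exists z; split=> //; have := dT u z y; have := dT z x y; have : d u y == 1 by [rewrite d1]; lia.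
Qed.

Lemma point_unique x y z z' : d x z + d z y = d x y -> d x z' + d z' y = d x y ->
  d x z = d x z' -> z = z'.
Proof.
move: {2}(d z y) (erefl (d z y)) => j; elim: j y => [|j IH] y zy b b' E.
  have z'y : d z' y = 0 by lia.
  by rewrite (d0_eq zy) (d0_eq z'y).
have pred u : d x u + d u y = d x y -> d u y = j.+1 ->
    exists v, [/\ edge v y, d x y = (d x v).+1 & d x u + d u v = d x v].
  move=> bu uy; have nuy : u != y by rewrite -dP uy.
  have [v [e dv]] := d_step nuy; exists v.
  by have := d_edge x e; have := dT u x v; split=> //; lia.
have [v [e dv bv]] := pred z b zy; have [|v' [e' dv' bv']] := pred z' b'; first by lia.
have vv : v' = v by apply: (@d_closer x y); rewrite // edge_sym.
by rewrite vv in bv'; apply: (IH v); lia.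
Qed.

(** Geodesics that overlap in a nontrivial segment concatenate. If the last step, from [v] to [w],
    came closer to [x], then [w] would be the unique neighbour of [v] closer to [x], which is the
    preceding vertex [u]. *)
Lemma concat x y z w : y != z -> d x y + d y z = d x z -> d y z + d z w = d y w ->
  d x w = d x z + d z w.
Proof.
move=> yz bx; move: {2}(d z w) (erefl (d z w)) => j; elim: j w => [|j IH] w zw bw.
  by rewrite -(d0_eq zw) distxx addn0.
have nzw : z != w by rewrite -dP zw.
have [v [e dv]] := d_step nzw.
have bv : d y z + d z v = d y v by have := d_edge y e; have := dT z y v; lia.
have IHv : d x v = d x z + d z v by apply: IH; lia.
have [|xw] := d_edge x e; first by lia.
have [zv|nzv] := eqVneq z v.
  rewrite -zv in e dv bv IHv xw *.
  rewrite distxx in dv.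
  have [u [eu du]] := d_step yz.
  have uw : u = w.
    apply: (@d_closer x z) => //; first by rewrite edge_sym.
    by have := d_edge x eu; have := dT y x u; lia.
  by rewrite uw in du; lia.
have [u [eu du]] := d_step nzv.
have uw : u = w.
  apply: (@d_closer x v) => //; first by rewrite edge_sym.
  by have := d_edge x eu; have := dT z x u; lia.
by rewrite uw in du; lia.
Qed.

(** [m] is a point between [y] and [z] nearest to [x]. A step from [m] towards either end leads away
    from [x], so [concat] applies. *)
Lemma median x y z : exists m : G,
  [/\ d x m + d m y = d x y, d x m + d m z = d x z & d y m + d m z = d y z].
Proof.
have yB : d y y + d y z == d y z by rewrite distxx.
case: (arg_minnP (fun m => d x m) (P := fun m : G => d y m + d m z == d y z) yB) => m /eqP mB mmin.
have main v u : d v m + d m u = d v u ->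
   (forall w, d v w + d w u = d v u -> d x m <= d x w) -> d x m + d m u = d x u.
  move=> vB vmin; have [mu|nmu] := eqVneq m u; first by rewrite -mu distxx addn0.
  have mu1 : 0 < d m u by rewrite lt0n dP.
  have [w [mw wu]] := point mu1.
  have nmw : m != w by rewrite -dP mw.
  have emw : edge m w by rewrite -d1 mw.
  have vw := dT m v w; have vu := dT w v u.
  have : d x m <= d x w by apply: vmin; lia.
  have [xw|] := d_edge x emw; last by lia.
  by move=> _; rewrite (@concat x m w u nmw); lia.
exists m; split=> //.
- apply: (main z); first by move: (dC z m) (dC m y) (dC z y); lia.
  by move=> w wB; apply/mmin/eqP; move: (dC z w) (dC w y) (dC z y); lia.
- by apply: (main y) => // w wB; apply/mmin/eqP.
Qed.

Lemma star_geod a S x y : star a S -> x \in S -> d a y + d y x = d a x -> y \in S.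
Proof.
case=> aS st; move: {2}(d y x) (erefl (d y x)) => j; elim: j x => [|j IH] x yx xS b.
  by rewrite (d0_eq yx).
have nax : x != a by apply/eqP => xa; rewrite xa distxx in b; move: yx; rewrite xa; lia.
have nyx : y != x by rewrite -dP yx.
have [z [zS e dz]] := st x xS nax.
have [u [eu du]] := d_step nyx.
have uz : u = z.
  apply: (@d_closer a x) => //; [by rewrite edge_sym|by rewrite edge_sym|].
  by have := d_edge a eu; have := dT y a u; lia.
by apply: (IH z) => //; rewrite -uz; have := d_edge a eu; have := dT y a u; lia.
Qed.

(** The median [m] of [a], [x], [y] cuts the geodesic from [x] to [y] into two halves, each part of
    a geodesic to [a]. *)
Lemma star_convex a S x y z : star a S -> x \in S -> y \in S ->
  d x z + d z y = d x y -> z \in S.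
Proof.
have half u v m : d a m + d m u = d a u -> d u m + d m v = d u v ->
    d u z + d z v = d u v -> star a S -> u \in S -> d u z <= d u m -> z \in S.
  move=> am um uz st uS le; have [z' [xz z'm]] := point le.
  have t1 := dT z' u v; have t2 := dT m z' v.
  have -> : z = z' by apply: (@point_unique u v); lia.
  have t3 := dT m a z'; have t4 := dT z' a u.
  by apply: (star_geod st uS); move: (dC u z') (dC m z') (dC u m); lia.
move=> st xS yS zB; have [m [amx amy xmy]] := median a x y.
have [le|le] := leqP (d x z) (d x m); first exact: (half x y m).
by apply: (half y x m) => //; move: (dC z x) (dC z y) (dC x y) (dC m x) (dC m y); lia.
Qed.

End TreeMetric.

(** Geodesics between points of [S] stay in [S] by convexity; their injective images are paths, and
    in an acyclic graph every path is a geodesic. Copies of subtrees are thus isometric maps. *)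
Lemma isom_star (G K : sgraph) (a : G) (S : {set G}) (f : G -> K) :
    is_tree G -> acyclic K -> star a S -> {in S &, injective f} ->
    {in S &, {homo f : x y / edge x y}} ->
  {in S &, forall x y, dist (f x) (f y) = dist x y}.
Proof.
move=> Gt Ka st fI fE x y xS yS.
have [p [pp pl ps up add]] := geodesic (Gt.1.2 x y).
have pS : {subset x :: p <= S}.
  by move=> z /add; apply: (star_convex Gt st xS yS).
rewrite -ps; have -> : f y = last (f x) (map f p) by rewrite last_map pl.
rewrite (path_dist Ka) ?size_map //; last first.
  rewrite -[_ :: _]/(map f (x :: p)) map_inj_in_uniq // => u v /pS uS /pS vS; exact: fI.
rewrite path_map; elim: p x {xS pl ps up add} pp pS => //= z p IH x /andP[xz pp] pS.
rewrite fE ?IH ?pS ?inE ?eqxx ?orbT // => u up; apply: pS; rewrite inE up orbT //.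
Qed.

Lemma isom_inj (G K : sgraph) (S : {set G}) (f : G -> K) : is_tree G ->
  {in S &, forall x y, dist (f x) (f y) = dist x y} -> {in S &, injective f}.
Proof.
by move=> Gt fi x y xS yS E; apply: (d0_eq Gt); rewrite -fi // E distxx.
Qed.

(* Isometric maps on [S], made canonical outside of [S] by sending everything
   there to the image of [a]. *)
Definition emb (G K : sgraph) (S : {set G}) (a : G) : {set {ffun G -> K}} :=
  [set f : {ffun G -> K} | [forall x, (x \notin S) ==> (f x == f a)] &
     [forall x in S, forall y in S, dist (f x) (f y) == dist x y]].

Lemma embP (G K : sgraph) (S : {set G}) (a : G) (f : {ffun G -> K}) :
  reflect ((forall x, x \notin S -> f x = f a) /\
           {in S &, forall x y, dist (f x) (f y) = dist x y}) (f \in emb K S a).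
Proof.
rewrite inE; apply: (iffP andP) => [[/forallP f1 /forall_inP f2]|[f1 f2]]; split.
- by move=> x xS; apply/eqP; have /implyP := f1 x; apply.
- by move=> x y /f2/forall_inP xP yS; apply/eqP/xP.
- by apply/forallP => x; apply/implyP => /f1 ->.
- by apply/forall_inP => x xS; apply/forall_inP => y yS; rewrite f2.
Qed.

Lemma card_emb (G K : sgraph) (S : {set G}) (a : G) :
  is_tree G -> is_tree K -> star a S -> #|emb K S a| = #|homs (induced S) K|.
Proof.
move=> Gt Kt st; have aS := st.1.
pose c (f : {ffun induced S -> K}) : {ffun G -> K} :=
  [ffun x => f (insubd (exist _ a aS : induced S) x)].
have cv f (u : induced S) : c f (val u) = f u by rewrite ffunE valKd.
have cI : injective c.
  by move=> f g fg; apply/ffunP => u; rewrite -!cv fg.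
rewrite -(card_imset _ cI); apply/esym/eq_card => f.
apply/imsetP/embP => [[g /homsP[gI gE] ->]|[f1 f2]].
  split.
    move=> x xS; rewrite -[a in RHS]/(val (exist _ a aS : induced S)) cv.
    by rewrite ffunE /insubd insubN.
  apply: (isom_star Gt Kt.2 st) => x y xS yS.
    by rewrite -[x]/(val (exist _ x xS : induced S)) -[y]/(val (exist _ y yS : induced S)) !cv => /gI ->.
  rewrite -[x]/(val (exist _ x xS : induced S)) -[y]/(val (exist _ y yS : induced S)) !cv => e.
  exact: gE.
exists [ffun u => f (val u)].
  apply/homsP; split=> [u v|u v e]; rewrite !ffunE.
    by move/(isom_inj Gt f2) => E; apply/val_inj/E; apply: valP.
  by rewrite -(d1 Kt) f2 ?(d1 Gt) //; apply: valP.
apply/ffunP => x; rewrite !ffunE; have [xS|xS] := boolP (x \in S).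
  by rewrite insubdK.
by rewrite f1 // /insubd insubN.
Qed.

Lemma emb_neq0 (G : sgraph) (S : {set G}) (a : G) : a \in S -> 0 < #|emb G S a|.
Proof.
move=> aS; apply/card_gt0P; exists [ffun x => if x \in S then x else a].
apply/embP; split=> [x /negPf xS|x y xS yS]; first by rewrite !ffunE aS xS.
by rewrite !ffunE xS yS.
Qed.

(** * Recognizing trees *)

Lemma card_induced (G : sgraph) (A : {set G}) : #|induced A| = #|A|.
Proof. by rewrite card_sig; apply: eq_card. Qed.

Section PathGraph.
Variable j : nat.
Definition path_edge : rel 'I_j := fun a b => (a.+1 == b) || (b.+1 == a).
Lemma path_edge_sym : symmetric path_edge.
Proof. by move=> a b; rewrite /path_edge orbC. Qed.
Lemma path_edge_irr : irreflexive path_edge.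
Proof. by move=> a; rewrite /path_edge orbb; apply/negP; lia. Qed.
Definition pathG : sgraph := SGraph path_edge_sym path_edge_irr.
End PathGraph.

Lemma sorted_enum_ord j : sorted (@edge (pathG j)) (enum 'I_j).
Proof.
have : sorted (fun a b => (a.+1 == b) || (b.+1 == a)) (map val (enum 'I_j)).
  rewrite val_enum_ord; elim: j 0 => // j IH m /=.
  by case: j IH => //= j /(_ m.+1) /= ->; rewrite eqxx.
by rewrite sorted_map.
Qed.

Lemma nth_codom_ord (X : Type) j (f : 'I_j.+1 -> X) (i : 'I_j.+1) x0 :
  nth x0 (codom f) i = f i.
Proof. by rewrite codomE (nth_map ord0) ?size_enum_ord // nth_ord_enum. Qed.

Lemma pathG_codom j (G : sgraph) (f : {ffun pathG j.+1 -> G}) : f \in homs (pathG j.+1) G ->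
  exists p, [/\ codom f = f ord0 :: p, path (@edge G) (f ord0) p, uniq (f ord0 :: p),
                last (f ord0) p = f ord_max & size p = j].
Proof.
move=> /homsP[fI fE].
have sE : sorted (@edge G) (codom f).
  by rewrite /codom /image_mem; apply: (homo_sorted fE) (sorted_enum_ord j.+1).
have uE : uniq (codom f) by apply/injectiveP.
have ss : size (codom f) = j.+1 by rewrite size_codom card_ord.
have n0 := nth_codom_ord f ord0 (f ord0); have nj := nth_codom_ord f ord_max (f ord0).
move: n0 nj => /= n0 nj.
case: (codom f) sE uE ss n0 nj => //= x p; move=> pp up [ps] xE; rewrite xE in pp up *.
by move=> nj; exists p; split=> //; rewrite (last_nth (f ord0)) ps.
Qed.

Lemma homs_path_le (T : sgraph) j : is_tree T ->
  #|homs (pathG j.+1) T| <= #|[set p : T * T | dist p.1 p.2 == j]|.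
Proof.
move=> Tt; pose c (f : {ffun pathG j.+1 -> T}) := (f ord0, f ord_max).
have cI : {in homs (pathG j.+1) T &, injective c}.
  move=> f g /pathG_codom [p [fp pp up lp _]] /pathG_codom [q [gq qq uq lq _]] [E0 Em].
  have pq : p = q.
    by apply: (uniq_path_unique Tt.2 pp _ up); rewrite ?E0 // -E0 lp Em -lq E0.
  apply/ffunP => i; rewrite -(nth_codom_ord f i (f ord0)) -(nth_codom_ord g i (f ord0)).
  by rewrite fp gq E0 pq.
rewrite -(card_in_imset cI); apply/subset_leq_card/subsetP => _ /imsetP[f fH ->].
have [p [_ pp up lp ps]] := pathG_codom fH.
by rewrite inE /= -lp (path_dist Tt.2 pp up) ps.
Qed.

(** A path in a tree is determined by its ordered pair of ends, and such a pair is counted for one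
    length only. *)
Lemma sum_homs_path_le (T : sgraph) k : is_tree T ->
  \sum_(1 <= j < k) #|homs (pathG j.+1) T| <= #|T| * #|T|.-1.
Proof.
move=> Tt.
apply: (@leq_trans (\sum_(1 <= j < k) #|[set p : T * T | dist p.1 p.2 == j]|)).
  by apply: leq_sum => j _; apply: homs_path_le.
have -> : #|T| * #|T|.-1 = #|[set p : T * T | p.1 != p.2]|.
  have := cardsC [set p : T * T | p.1 == p.2]; rewrite card_prod.
  have -> : #|[set p : T * T | p.1 == p.2]| = #|T|.
    rewrite -(card_imset (mem T) (f := fun x : T => (x, x))) => [|x y [] //].
    apply: eq_card => [[x y]]; rewrite inE /=; apply/eqP/imsetP => [->|[z _ [-> ->]] //].
    by exists y.
  have -> : ~: [set p : T * T | p.1 == p.2] = [set p | p.1 != p.2].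
    by apply/setP => p; rewrite !inE.
  by case: #|T| => [|n] /=; nia.
under eq_bigr => j _ do rewrite -sum1dep_card big_mkcond.
rewrite exchange_big -sum1dep_card [X in _ <= X]big_mkcond /=; apply: leq_sum => p _.
have -> : \sum_(1 <= j < k) (if dist p.1 p.2 == j then 1 else 0) =
          count_mem (dist p.1 p.2) (index_iota 1 k).
  by rewrite count_sum; apply: eq_bigr => j _; rewrite /= eq_sym; case: eqP.
rewrite count_uniq_mem ?iota_uniq // mem_index_iota; case: eqP => [->|_]; last by case: (_ && _).
by rewrite distxx.
Qed.

Section LongCycle.
Variables (G : sgraph) (c : seq G).
Hypotheses (cG : ucycle (@edge G) c) (c3 : 2 < size c).
Local Notation g := (size c).

Let g0 : 0 < g. Proof. by move: c3; lia. Qed.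

(** The cycle is unrolled into a [g]-periodic sequence, so that paths around it need no case
    distinction at a base point. *)
Lemma ucycle_nth : exists h : nat -> G,
  (forall i, edge (h i) (h i.+1)) /\ (forall i j, h i = h j -> i = j %[mod g]) /\
  (forall i, h (i + g) = h i).
Proof.
have [x0 [p cE]] : exists x0 p, c = x0 :: p by case: (c) c3 => // x p _; exists x, p.
exists (fun i => nth x0 c (i %% g)); split; last split.
- move=> i; have im : i %% g < g by rewrite ltn_mod.
  have [cyc _] := andP cG; rewrite cE /= in cyc; have /pathP-/(_ x0 (i %% g)) := cyc.
  rewrite size_rcons -[(size p).+1]/(size (x0 :: p)) -cE => /(_ im).
  have -> : nth x0 (x0 :: rcons p x0) (i %% g) = nth x0 c (i %% g).
    by rewrite -rcons_cons -cE nth_rcons im.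
  congr edge; rewrite -addn1 -modnDml addn1; move: im; rewrite leq_eqVlt => /orP[/eqP im|im].
    have ip : i %% g = size p by move: im; rewrite {2}cE /= => -[].
    by rewrite im modnn nth_rcons ip ltnn eqxx cE.
  rewrite (modn_small im) nth_rcons.
  have -> : i %% g < size p by move: im; rewrite {2}cE.
  by have -> : nth x0 c (i %% g).+1 = nth x0 p (i %% g) by rewrite {1}cE.
- move=> i j /eqP; rewrite nth_uniq ?ltn_mod //; last by case/andP: cG.
  by move/eqP.
- by move=> i; rewrite modnDr.
Qed.

Lemma homs_path_cycle j : 0 < j < g -> 2 * g <= #|homs (pathG j.+1) G|.
Proof.
move=> jg; have [h [hE [hI hg]]] := ucycle_nth.
(* A path is given by its start and its direction; adding [g] keeps the subtraction from truncating,
   as [a <= j < g]. *)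
pose c' (q : 'I_g * bool) : {ffun pathG j.+1 -> G} :=
  [ffun a : 'I_j.+1 => if q.2 then h (q.1 + a) else h (q.1 + g - a)].
have -> : 2 * g = #|[set: 'I_g * bool]| by rewrite cardsT card_prod card_ord card_bool mulnC.
have cI : injective c'.
  have inj1 (i i' : nat) : i < g -> i' < g -> h i = h i' -> i = i'.
    by move=> ig ig' /hI; rewrite !modn_small.
  move=> [q b] [q' b'] /ffunP E.
  have qq' : q = q'.
    apply/val_inj/inj1; rewrite ?ltn_ord //; have := E ord0; rewrite !ffunE /= !addn0 !subn0.
    by case: (b); case: (b'); rewrite ?hg.
  move: qq' E => -> E; congr pair.
  have j1 : 1 < j.+1 by lia.
  have := E (Ordinal j1); rewrite !ffunE /=.
  have no : h (q' + 1) = h (q' + g - 1) -> False.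
    have -> : q' + g - 1 = q' + (g - 1) by lia.
    by move/hI/eqP; rewrite eqn_modDl !modn_small; lia.
  by case: (b); case: (b') => // E1; exfalso; apply: no; rewrite E1.
rewrite -(card_imset _ cI); apply/subset_leq_card/subsetP => _ /imsetP[[q b] _ ->].
have qg := ltn_ord q.
apply/homsP; split=> [a a'|a a']; rewrite !ffunE /=; have ag := ltn_ord a; have ag' := ltn_ord a'.
  case: b => /hI/eqP E; apply/val_inj => /=.
    by move: E; rewrite eqn_modDl !modn_small; lia.
  move: E; have -> : q + g - a = q + (g - a) by lia.
  have -> : q + g - a' = q + (g - a') by lia.
  rewrite eqn_modDl; case: (posnP a) => [->|a0]; case: (posnP a') => [->|a0'] //;
  rewrite ?subn0 ?modnn ?modn_small; lia.
rewrite /edge /= /path_edge; have hE' i i' : i.+1 = i' \/ i'.+1 = i -> edge (h i) (h i').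
  by case=> <-; rewrite // edge_sym.
by move=> /orP[]/eqP aa; case: b; apply: hE'; lia.
Qed.

Lemma ucycle_homs (K : sgraph) : 0 < #|homs (induced [set x in c]) K| ->
  exists c' : seq K, size c' = g /\ ucycle (@edge K) c'.
Proof.
case/card_gt0P => f /homsP[fI fE].
have lift (S : {set G}) (q : seq G) : all (mem S) q -> exists s : seq (induced S), map val s = q.
  elim: q => [|x p IH] /=; first by exists [::].
  by case/andP=> xS /IH [s <-]; exists (exist _ x xS :: s).
have [|s sc] := lift [set x in c] c; first by apply/allP => x /=; rewrite inE.
have [cs us] := andP cG.
exists (map f s); rewrite size_map; split; first by rewrite -(size_map val) sc.
apply/andP; split; first by apply: (homo_cycle fE); have := cs; rewrite -{1}sc cycle_map.
by rewrite map_inj_uniq //; apply: (@map_uniq _ _ val); rewrite sc.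
Qed.
End LongCycle.

Lemma acyclic_deck (T H : sgraph) (k l : nat) :
    is_tree T -> #|H| = #|T| -> #|T| = k + l -> 5 * l + 11 <= k ->
    deck H k =1 deck T k -> acyclic H.
Proof.
move=> Tt HT Tn kl dk c c3 cH.
have kT : k <= #|T| by lia.
have [ck|kc] := leqP (size c) k.
  have : 0 < #|homs (induced [set x in c]) T|.
    rewrite -(deck_homs HT _ dk); last first.
      by rewrite kT andbT card_induced cardsE (leq_trans (card_size c)).
    apply/card_gt0P; exists [ffun x => val x]; apply/homsP.
    by split=> [x y|x y]; rewrite !ffunE // => /val_inj.
  by case/(ucycle_homs cH) => c' [sc' /(Tt.2 c')]; apply; rewrite sc'.
(* Each of the [k - 1] lengths contributes at least [2 * (k + 1)] labelled paths, in total more than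
   [(k + l) * (k + l - 1)] since [5 * l + 11 <= k]. *)
have := sum_homs_path_le k Tt.
have : \sum_(1 <= j < k) (2 * size c) <= \sum_(1 <= j < k) #|homs (pathG j.+1) T|.
  rewrite big_nat_cond [X in _ <= X]big_nat_cond; apply: leq_sum => j /andP[/andP[j1 jk] _].
  rewrite -(deck_homs HT _ dk); last by rewrite card_ord; lia.
  by apply: (homs_path_cycle cH c3); lia.
rewrite sum_nat_const_nat; nia.
Qed.

Definition arcs (G : sgraph) : {set G * G} := [set p | edge p.1 p.2].

Lemma homs_arcs (G : sgraph) : #|homs (pathG 2) G| = #|arcs G|.
Proof.
pose c (f : {ffun pathG 2 -> G}) := (f ord0, f ord_max).
have cI : injective c.
  move=> f g [E0 E1]; apply/ffunP => [[[|[|//]] i]].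
    by have -> : Ordinal i = ord0 by apply: val_inj.
  by have -> : Ordinal i = ord_max by apply: val_inj.
rewrite -(card_imset _ cI); apply: eq_card => [[x y]]; rewrite inE /=.
apply/imsetP/idP => [[f fH [-> ->]]|xy].
  by have [_] := elimT (@homsP (pathG 2) G f) fH; apply.
exists [ffun i : 'I_2 => if i == ord0 then x else y]; last by rewrite /c !ffunE.
have nxy : x != y by apply/eqP => E; rewrite E edge_irr in xy.
apply/(@homsP (pathG 2) G); split=> [[[|[|//]] i] [[|[|//]] j]|[[|[|//]] i] [[|[|//]] j]]; rewrite !ffunE //=.
- by move=> _; apply: val_inj.
- by move/eqP; rewrite (negPf nxy).
- by move/eqP; rewrite eq_sym (negPf nxy).
- by move=> _; apply: val_inj.
- by rewrite edge_sym.
Qed.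

Lemma tree_arcs (T : sgraph) : is_tree T -> 2 * #|T|.-1 <= #|arcs T|.
Proof.
move=> Tt; case/card_gt0P: (Tt.1.1) => r _.
pose par x := odflt x [pick z | edge z x && (dist r x == (dist r z).+1)].
have parP x : x != r -> edge (par x) x /\ dist r x = (dist r (par x)).+1.
  rewrite eq_sym => /(d_step Tt) [z [e dz]]; rewrite /par; case: pickP => [u /andP[? /eqP]|/(_ z)] //.
  by rewrite e dz eqxx.
pose S := [set q : T * bool | q.1 != r].
have cS : #|S| = 2 * #|T|.-1.
  have -> : S = setX [set~ r] [set: bool] by apply/setP => q; rewrite !inE andbT.
  by rewrite cardsX cardsC1 cardsT card_bool mulnC.
pose c (q : T * bool) := if q.2 then (q.1, par q.1) else (par q.1, q.1).
have cI : {in S &, injective c}.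
  move=> [x b] [y b']; rewrite !inE /= => /parP[_ dx] /parP[_ dy].
  rewrite /c /=; case: b; case: b' => -[xy yx].
  - by rewrite xy.
  - by rewrite yx in dx; rewrite -xy in dy; lia.
  - by rewrite xy in dx; rewrite -yx in dy; lia.
  - by rewrite yx.
rewrite -cS -(card_in_imset cI); apply/subset_leq_card/subsetP => _ /imsetP[[x b] xS ->].
move: xS; rewrite !inE /= => /parP[e _]; rewrite /c; case: b => //=.
by rewrite edge_sym.
Qed.

(** Every arc is charged to its deeper end together with its direction. Component roots are never
    charged, so this many arcs leave room for only one root. *)
Lemma acyclic_arcs (H : sgraph) : acyclic H -> 0 < #|H| -> 2 * #|H|.-1 <= #|arcs H| ->
  connected H.
Proof.
move=> Ha H0 le; split=> //.
(* Here [oiso x] is the canonical representative of the component of [x], and [dep x] the depth of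
   [x] below it. *)
pose oiso := root (@edge H); pose dep x := dist (oiso x) x.
have Rc x : connect (@edge H) (oiso x) x by rewrite connect_symG; apply: connect_root.
have Re x y : edge x y -> oiso x = oiso y.
  by move=> /connect1 c; apply/eqP; rewrite root_connect //; apply: connect_symG.
have De x y : edge x y -> dep y = (dep x).+1 \/ dep x = (dep y).+1.
  by move=> e; rewrite /dep -(Re _ _ e); exact: (dist_edge Ha (Rc x) e).
pose S := [set q : H * bool | oiso q.1 != q.1].
have cS : #|S| = 2 * #|[set x | oiso x != x]|.
  have -> : S = setX [set x | oiso x != x] [set: bool] by apply/setP => q; rewrite !inE andbT.
  by rewrite cardsX cardsT card_bool mulnC.
pose c (q : H * H) := if dep q.1 == (dep q.2).+1 then (q.1, true) else (q.2, false).
have cI : {in arcs H &, injective c}.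
  move=> [x y] [x' y']; rewrite !inE /c /= => xy xy'.
  have D := De _ _ xy; have D' := De _ _ xy'.
  case: eqP => E; case: eqP => E' // [F].
    rewrite -F in xy' E' *; congr pair; apply: (closer_unique Ha (Rc x) xy xy').
      by move: E; rewrite /dep -(Re _ _ xy).
    by move: E'; rewrite /dep -(Re _ _ xy').
  rewrite -F in xy' E' D' *; congr pair.
  rewrite edge_sym in xy; rewrite edge_sym in xy'.
  apply: (closer_unique Ha (Rc y) xy xy').
    by move: D E; rewrite /dep -(Re _ _ xy); lia.
  by move: D' E'; rewrite /dep -(Re _ _ xy'); lia.
have lt : #|arcs H| <= #|S|.
  rewrite -(card_in_imset cI); apply/subset_leq_card/subsetP => _ /imsetP[[x y] xy ->].
  move: xy; rewrite inE /c /= => xy.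
  have D := De _ _ xy.
  have nz z : dep z != 0 -> oiso z != z by apply: contra => /eqP E; rewrite /dep E distxx.
  by case: eqP => E; rewrite inE /=; apply: nz; lia.
have roots1 : #|[set x | oiso x == x]| <= 1.
  have := cardsC [set x | oiso x == x]; have -> : ~: [set x | oiso x == x] = [set x | oiso x != x].
    by apply/setP => x; rewrite !inE.
  lia.
move=> x y; rewrite -(root_connect (@connect_symG H)).
have RR z : oiso z \in [set x | oiso x == x] by rewrite inE; apply/eqP/root_root/connect_symG.
by apply/eqP/esym; have := elimT card_le1_eqP roots1 _ _ (RR x) (RR y).
Qed.

Lemma tree_deck (T H : sgraph) (k l : nat) :
    is_tree T -> #|H| = #|T| -> #|T| = k + l -> 5 * l + 11 <= k ->
    deck H k =1 deck T k -> is_tree H.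
Proof.
move=> Tt HT Tn kl dk; have Ha := acyclic_deck Tt HT Tn kl dk; split=> //.
apply: acyclic_arcs => //; first by rewrite HT; lia.
by rewrite -homs_arcs (deck_homs HT _ dk) ?card_ord ?homs_arcs ?HT ?tree_arcs //; lia.
Qed.

(** * Marked subtrees *)

(** The two marks are the ends of the spine segment for a window, and both are the root for a
    letter. *)
Record obj := Obj {
  og : sgraph; oS : {set og}; oa : og; ob : og;
  og_tree : is_tree og; oaS : oa \in oS; obS : ob \in oS }.

Definition omaps (X Y : obj) : {set {ffun og X -> og Y}} :=
  [set f in emb (og Y) (oS X) (oa X) |
     [&& f (oa X) == oa Y, f (ob X) == ob Y & [forall x in oS X, f x \in oS Y]]].

Lemma omapsP (X Y : obj) (f : {ffun og X -> og Y}) :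
  reflect [/\ forall x, x \notin oS X -> f x = oa Y,
              {in oS X &, forall x y, dist (f x) (f y) = dist x y},
              f (oa X) = oa Y, f (ob X) = ob Y & forall x, f x \in oS Y]
          (f \in omaps X Y).
Proof.
rewrite inE; apply: (iffP andP) => [[/embP[f1 f2] /and3P[/eqP fa /eqP fb /forall_inP fS]]|[f1 f2 fa fb fS]].
  split=> // [x /f1|x]; first by rewrite fa.
  by have [/fS //|/f1 ->] := boolP (x \in oS X); rewrite fa oaS.
split; first by apply/embP; split=> // x /f1 ->.
by rewrite fa fb !eqxx /=; apply/forall_inP => x _; apply: fS.
Qed.

Definition nmaps (X Y : obj) : nat := #|omaps X Y|.

(** Isomorphism of marked subtrees: an isometric map is injective, hence onto when the sizes
    agree. *)
Definition oiso (X Y : obj) : bool := (#|oS X| == #|oS Y|) && (0 < nmaps X Y).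

Lemma nmaps_gt0 (X Y : obj) (f : og X -> og Y) :
    {in oS X &, forall x y, dist (f x) (f y) = dist x y} ->
    f (oa X) = oa Y -> f (ob X) = ob Y -> {in oS X, forall x, f x \in oS Y} ->
  0 < nmaps X Y.
Proof.
move=> f2 fa fb fS; apply/card_gt0P.
exists [ffun x => if x \in oS X then f x else oa Y]; apply/omapsP; split.
- by move=> x /negPf xS; rewrite ffunE xS.
- by move=> x y xS yS; rewrite !ffunE xS yS f2.
- by rewrite ffunE oaS.
- by rewrite ffunE obS.
- by move=> x; rewrite ffunE; case: ifP => [/fS //|_]; apply: oaS.
Qed.

Lemma nmaps_refl (X : obj) : 0 < nmaps X X.
Proof. exact: (@nmaps_gt0 X X id). Qed.

Lemma nmaps_card (X Y : obj) : 0 < nmaps X Y -> #|oS X| <= #|oS Y|.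
Proof.
case/card_gt0P => f /omapsP[_ f2 _ _ fS].
rewrite -(card_in_imset (isom_inj (og_tree X) f2)).
by apply/subset_leq_card/subsetP => _ /imsetP[x _ ->].
Qed.

Lemma nmaps_comp (X Y Z : obj) : 0 < nmaps Y Z -> nmaps X Y <= nmaps X Z.
Proof.
case/card_gt0P => h /omapsP[h1 h2 ha hb hS].
pose c (f : {ffun og X -> og Y}) : {ffun og X -> og Z} := [ffun x => h (f x)].
have hI := isom_inj (og_tree Y) h2.
have cI : {in omaps X Y &, injective c}.
  move=> f g /omapsP[_ _ _ _ fS] /omapsP[_ _ _ _ gS] /ffunP E; apply/ffunP => x.
  by have := E x; rewrite !ffunE => /hI; apply.
rewrite /nmaps -(card_in_imset cI); apply/subset_leq_card/subsetP => _ /imsetP[f /omapsP[f1 f2 fa fb fS] ->].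
apply/omapsP; split=> [x xS|x y xS yS|||x]; rewrite !ffunE.
- by rewrite f1.
- by rewrite h2 ?fS // f2.
- by rewrite fa.
- by rewrite fb.
- exact: hS.
Qed.

Lemma nmaps_inv (X Y : obj) : oiso X Y -> 0 < nmaps Y X.
Proof.
case/andP=> /eqP XY /card_gt0P[h /omapsP[h1 h2 ha hb hS]].
have hI := isom_inj (og_tree X) h2.
have im : h @: oS X = oS Y.
  apply/eqP; rewrite eqEcard card_in_imset // XY leqnn andbT.
  by apply/subsetP => _ /imsetP[x _ ->].
pose g y := odflt (oa X) [pick x in oS X | h x == y].
have gP y : y \in oS Y -> g y \in oS X /\ h (g y) = y.
  rewrite -im => /imsetP[x xS ->]; rewrite /g; case: pickP => [z /andP[zS /eqP]|/(_ x)] //.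
  by rewrite xS eqxx.
have gh x : x \in oS X -> g (h x) = x.
  by move=> xS; have [gS E] := gP _ (hS x); apply: hI.
apply: (@nmaps_gt0 Y X g).
- move=> x y /gP[xS hx] /gP[yS hy]; by rewrite -{2}hx -{2}hy h2.
- by rewrite -ha gh ?oaS.
- by rewrite -hb gh ?obS.
- by move=> y /gP[].
Qed.

Lemma oiso_refl X : oiso X X.
Proof. by rewrite /oiso eqxx nmaps_refl. Qed.

Lemma oiso_trans X Y Z : oiso X Y -> oiso X Z = oiso Y Z.
Proof.
move=> XY; have YX := nmaps_inv XY; have /andP[/eqP c xy] := XY.
rewrite /oiso c; case: (_ == _) => //=; apply/idP/idP => h.
  exact: leq_trans YX (nmaps_comp _ h).
exact: leq_trans xy (nmaps_comp _ h).
Qed.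

Lemma oiso_sym X Y : oiso X Y = oiso Y X.
Proof. by apply/idP/idP => h; rewrite -(oiso_trans _ h) oiso_refl. Qed.

Lemma nmaps_oiso X Y Z : oiso Y Z -> nmaps X Y = nmaps X Z.
Proof.
move=> YZ; apply/eqP; rewrite eqn_leq; have /andP[_ yz] := YZ.
by rewrite (nmaps_comp _ yz) (nmaps_comp _ (nmaps_inv YZ)).
Qed.

(** Equality as multisets of isomorphism classes, tested by all invariant weights instead of in a
    quotient. *)
Definition eqv (s t : seq obj) : Prop := forall psi : obj -> nat,
  (forall X Y, oiso X Y -> psi X = psi Y) -> \sum_(X <- s) psi X = \sum_(X <- t) psi X.

Lemma In_max (A : Type) (F : A -> nat) (s : seq A) : s <> [::] ->
  exists x, List.In x s /\ forall y, List.In y s -> F y <= F x.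
Proof.
elim: s => // x [|z s] IH _; first by exists x; split=> [|y []] //; [left|move=> <-].
have [//|u [us um]] := IH; have [le|lt] := leqP (F u) (F x).
  exists x; split; first by left.
  by move=> y [<- //|/um]; lia.
by exists u; split; [right|move=> y [<-|/um]; lia].
Qed.

(* A largest object on either side is the target of some isometry from the
   other side, which can only be an isomorphism. *)
Lemma triangular (s t : seq obj) :
    (forall X, List.In X (s ++ t) ->
       \sum_(Y <- s) nmaps X Y = \sum_(Y <- t) nmaps X Y \/ count (oiso X) s = count (oiso X) t) ->
  eqv s t.
Proof.
move: {2}(size (s ++ t)) (leqnn (size (s ++ t))) => n; elim: n s t => [|n IH] s t sn h psi hpsi.
  by case: s t sn h => [|//] [|//]; rewrite !big_nil.
have [/size0nil/(congr1 size)|ne] := eqVneq (size (s ++ t)) 0.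
  by rewrite size_cat; case: s t {sn h} => [|//] [|//]; rewrite !big_nil.
have [|x [xst xm]] := @In_max _ (fun X => #|oS X|) (s ++ t); first by move=> E; rewrite E in ne.
have step a b : (forall X, List.In X (a ++ b) ->
       \sum_(Y <- a) nmaps X Y = \sum_(Y <- b) nmaps X Y \/ count (oiso X) a = count (oiso X) b) ->
    (forall y, List.In y (a ++ b) -> #|oS y| <= #|oS x|) -> List.In x a ->
    exists a1 a2 b1 y b2, [/\ a = a1 ++ x :: a2, b = b1 ++ y :: b2 & oiso x y].
  move=> hab mab xa; have [a1 [a2 aE]] := List.in_split _ _ xa; exists a1, a2.
  have [E|E] := hab x (List.in_or_app _ _ _ (or_introl xa)).
    have : 0 < \sum_(Y <- b) nmaps x Y.
      by rewrite -E aE big_cat big_cons /=; have := nmaps_refl x; lia.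
    case/split_pos => b1 [y [b2 [bE xy]]]; exists b1, y, b2; split=> //.
    rewrite /oiso xy andbT eqn_leq nmaps_card //=; apply: mab.
    by apply: List.in_or_app; right; rewrite bE; apply: List.in_or_app; right; left.
  have : 0 < \sum_(Y <- b) oiso x Y.
    by rewrite -count_sum -E aE count_cat /= oiso_refl; lia.
  case/split_pos => b1 [y [b2 [bE xy]]]; exists b1, y, b2; split=> //.
  by move: xy; case: (oiso x y).
have main s1 x' s2 t1 y t2 : s = s1 ++ x' :: s2 -> t = t1 ++ y :: t2 -> oiso x' y ->
    \sum_(X <- s) psi X = \sum_(X <- t) psi X.
  move=> sE tE xy; suff E : \sum_(X <- s1 ++ s2) psi X = \sum_(X <- t1 ++ t2) psi X.
    by move: E; rewrite sE tE !big_cat !big_cons /= (hpsi _ _ xy); lia.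
  apply: IH => //; first by move: sn; rewrite sE tE !size_cat /=; lia.
  move=> X XI.
  have XI' : List.In X (s ++ t).
    rewrite sE tE; move: XI; do 8 rewrite ?List.in_app_iff /=; tauto.
  have [E|E] := h X XI'; [left|right].
    by move: E; rewrite sE tE !big_cat !big_cons /= (nmaps_oiso _ xy); lia.
  move: E; rewrite sE tE !count_cat /=.
  by rewrite (oiso_sym X x') (oiso_sym X y) (oiso_trans _ xy); lia.
case: (List.in_app_or _ _ _ xst) => [xs|xt].
  by have [a1 [a2 [b1 [y [b2 [aE bE xy]]]]]] := step s t h xm xs; apply: main aE bE xy.
have [||a1 [a2 [b1 [y [b2 [aE bE xy]]]]]] := step t s _ _ xt.
- move=> X XI; have [|E|E] := h X; last by right.
    by move: XI; rewrite !List.in_app_iff; tauto.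
  by left.
- by move=> y yI; apply: xm; move: yI; rewrite !List.in_app_iff; tauto.
by apply: main bE aE _; rewrite oiso_sym.
Qed.

Section Deck.
Variables (T H : sgraph) (k : nat).
Hypotheses (Tt : is_tree T) (Ht : is_tree H).
Hypothesis TH : forall F : sgraph, #|F| <= k -> #|homs F H| = #|homs F T|.

Lemma emb_deck (G : sgraph) (S : {set G}) (a : G) : is_tree G -> star a S ->
  #|S| <= k -> #|emb T S a| = #|emb H S a|.
Proof. by move=> Gt st Sk; rewrite !card_emb // TH // card_induced. Qed.

(** The inclusion of [S] into [T] is one of the maps counted, so the equal count for [H] is positive
    too. *)
Lemma transfer (S : {set T}) (a : T) : star a S -> #|S| <= k ->
  exists f : T -> H, {in S &, forall x y, dist (f x) (f y) = dist x y}.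
Proof.
move=> st Sk; have := emb_neq0 st.1; rewrite (emb_deck Tt st Sk) => /card_gt0P[f /embP[_ fi]].
by exists f.
Qed.
End Deck.

(** * Windows *)

Definition itv (G : sgraph) (b c : G) : {set G} := [set x | dist b x + dist x c == dist b c].

Definition win (G : sgraph) (l : nat) (a b : G) : {set G} :=
  [set x | [exists y in itv a b, dist x y <= l]].

(** Characterizes segments of the spine by distances alone, so that isometric maps carry them along:
    for [D > 0] these are the segments of the spine of length [D], in both directions
    ([spine_ext]). *)
Definition ext (G : sgraph) (l D : nat) (a b : G) : bool :=
  (dist a b == D) && [exists a', exists b',
     [&& dist a' a == l, dist b b' == l & dist a' b' == D + l + l]].

(** Metric form of excluding the spider with three legs of length [l.+1]; isometric maps transport
    it between trees. *)
Definition no_tripod (l : nat) (G : sgraph) : Prop :=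
  forall c z1 z2 z3 : G, dist c z1 = l.+1 -> dist c z2 = l.+1 -> dist c z3 = l.+1 ->
  dist z1 z2 = l.+1 + l.+1 -> dist z1 z3 = l.+1 + l.+1 -> dist z2 z3 = l.+1 + l.+1 -> False.

Section Windows.
Variable G : sgraph.
Hypothesis Gt : is_tree G.
Implicit Types (x y z a b c u : G) (S W : {set G}).
Local Notation d := (@dist G).
Let dC := dC Gt.
Let dT := dT Gt.

Lemma itvP x b c : reflect (d b x + d x c = d b c) (x \in itv b c).
Proof. by rewrite inE; apply: eqP. Qed.

Lemma geo_line b c x y : x \in itv b c -> y \in itv b c -> d b x <= d b y ->
  d b x + d x y = d b y.
Proof.
move=> /itvP xB /itvP yB le; have [z [bz zy]] := point Gt le.
have -> : x = z; last by lia.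
by apply: (point_unique Gt xB); have := dT z b c; have := dT y z c; lia.
Qed.

Lemma itv_sym b c : itv b c = itv c b.
Proof. by apply/setP => x; rewrite !inE (dC c b) (dC b x) (dC x c) addnC. Qed.

Lemma itv_star a b c : a \in itv b c -> star a (itv b c).
Proof.
move=> aI; split=> // x xI nxa; rewrite eq_sym in nxa.
have [u [e du]] := d_step Gt nxa; exists u; split=> //; rewrite inE; apply/eqP.
have main b' c' : a \in itv b' c' -> x \in itv b' c' -> d b' x <= d b' a ->
    d b' u + d u c' = d b' c'.
  move=> aI' xI' le; have := geo_line xI' aI' le.
  have ux : d u x = 1 by apply/eqP; rewrite (d1 Gt).
  move/itvP: aI' => aB; move/itvP: xI' => xB.
  have := dT x b' u; have := dT u b' c'; have := dT a u c'.
  by move: (dC x a) (dC u a) (dC u x); lia.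
have [le|lt] := leqP (d b x) (d b a); first exact: main aI xI le.
have aI' : a \in itv c b by rewrite itv_sym.
have xI' : x \in itv c b by rewrite itv_sym.
have := main _ _ aI' xI'; move/itvP: aI => aB; move/itvP: xI => xB.
move: (dC c x) (dC c a) (dC c u) (dC u b) (dC c b) => e1 e2 e3 e4 e5 main'.
by rewrite -e5 -main'; lia.
Qed.

Lemma card_itv b c : #|itv b c| <= (d b c).+1.
Proof.
pose f x : 'I_(d b c).+1 := inord (d b x).
have fI : {in itv b c &, injective f}.
  move=> x y /itvP xB /itvP yB /(congr1 (@nat_of_ord _)); rewrite /f !inordK; try lia.
  exact: (point_unique Gt xB yB).
by rewrite -(card_in_imset fI) -[X in _ <= X]card_ord max_card.
Qed.

Lemma starU a S W : star a S -> star a W -> star a (S :|: W).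
Proof.
move=> [aS sS] [_ sW]; split; first by rewrite inE aS.
move=> x; rewrite inE => /orP[xS|xW] nx.
  by have [y [yS e dy]] := sS x xS nx; exists y; rewrite inE yS.
by have [y [yS e dy]] := sW x xW nx; exists y; rewrite inE yS orbT.
Qed.

(** Repeatedly add a vertex of [W] outside [S] nearest to [a]: its neighbour towards [a] lies in [W]
    and is nearer, hence is already in [S]. *)
Lemma grow a S W m : star a S -> star a W -> S \subset W -> #|S| <= m <= #|W| ->
  exists S', [/\ star a S', S \subset S', S' \subset W & #|S'| = m].
Proof.
move=> sS sW; move: {2}(m - #|S|) (erefl (m - #|S|)) => j; elim: j S sS => [|j IH] S sS mj SW mW.
  by exists S; split=> //; lia.
have [x0 x0W x0S] : exists2 x0, x0 \in W & x0 \notin S.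
  by apply/subsetPn/negP => /subset_leq_card; lia.
have px0 : (x0 \in W) && (x0 \notin S) by rewrite x0W.
case: (arg_minnP (P := fun x => (x \in W) && (x \notin S)) (d a) px0) => x /andP[xW xS] xmin.
have nxa : x != a by apply/eqP => xa; rewrite xa sS.1 in xS.
have [y [yW e dy]] := sW.2 x xW nxa.
have yS : y \in S by apply: contraT => yS; have := xmin y; rewrite yW yS => /(_ isT); lia.
have [||||S' [s1 s2 s3 s4]] := IH (x |: S).
- split; first by rewrite inE sS.1 orbT.
  move=> z; rewrite !inE => /predU1P[->|zS] nz; first by exists y; rewrite !inE yS orbT.
  by have [w [wS ew dw]] := sS.2 z zS nz; exists w; rewrite !inE wS orbT.
- by rewrite cardsU1 xS; lia.
- by rewrite subUset sub1set xW.
- by rewrite cardsU1 xS; lia.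
by exists S'; split=> //; apply: subset_trans s2; apply: subsetUr.
Qed.

Section Win.
Variable l : nat.

Lemma winP x a b : reflect (exists2 y, d a y + d y b = d a b & d x y <= l) (x \in win l a b).
Proof.
rewrite inE; apply: (iffP exists_inP) => [[y /itvP yB yl]|[y yB yl]]; exists y => //.
by apply/itvP.
Qed.

Lemma win_l a b : a \in win l a b.
Proof. by apply/winP; exists a; rewrite distxx. Qed.

Lemma win_r a b : b \in win l a b.
Proof. by apply/winP; exists b; rewrite distxx ?addn0. Qed.

(** The geodesic from [x] to [a] first runs to the median [m] of [x], [a], [b], the point of the
    segment nearest to [x], and then along the segment; it never gets further than [l] from the
    segment. *)
Lemma win_star a b : star a (win l a b).
Proof.
split=> [|x xW nxa]; first exact: win_l.
have [m [xa xb ab]] := median Gt x a b.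
have ml : d x m <= l.
  case/winP: xW => y yB yl.
  have mI : m \in itv a b by apply/itvP; lia.
  have yI : y \in itv a b by apply/itvP; lia.
  have [le|lt] := leqP (d a y) (d a m).
    have := geo_line yI mI le; have := dT y x a.
    by move: (dC a m) (dC a y) (dC y m) (dC x a); lia.
  have := geo_line mI yI (ltnW lt); have := dT y x b.
  by move: (dC y m) (dC b m); lia.
have [xm|nxm] := eqVneq x m.
  have [|_ /(_ x) [||u [uI e du]]] := @itv_star a a b; first by apply/itvP; rewrite distxx.
  - by apply/itvP; rewrite xm; lia.
  - exact: nxa.
  exists u; split=> //; apply/winP; exists u; last by rewrite distxx.
  by apply/itvP.
rewrite eq_sym in nxm; have [u [e du]] := d_step Gt nxm.
have ux : d u x = 1 by apply/eqP; rewrite (d1 Gt).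
exists u; split=> //.
  apply/winP; exists m; first by move: (dC a m); lia.
  by move: (dC u m) (dC x m); lia.
have := d_edge Gt a e; have := dT m a u.
by move: (dC x a) (dC x m) (dC m a); lia.
Qed.

Definition wobj a b : obj := Obj Gt (win_l a b) (win_r a b).

Lemma extP D a b : reflect (d a b = D /\ exists a' b',
    [/\ d a' a = l, d b b' = l & d a' b' = D + l + l]) (ext l D a b).
Proof.
apply: (iffP andP) => [[/eqP ab /existsP[a' /existsP[b' /and3P[/eqP aa /eqP bb /eqP E]]]]|].
  by split=> //; exists a', b'.
move=> [ab [a' [b' [aa bb E]]]]; split; first exact/eqP.
by apply/existsP; exists a'; apply/existsP; exists b'; rewrite aa bb E !eqxx.
Qed.

Lemma ext_sym D a b : ext l D a b = ext l D b a.
Proof.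
have h u v : ext l D u v -> ext l D v u.
  case/extP => uv [u' [v' [uu vv E]]]; apply/extP; split; first by rewrite dC.
  by exists v', u'; rewrite dC vv dC uu dC E.
by apply/idP/idP; apply: h.
Qed.
End Win.
End Windows.

Lemma isom_win (G K : sgraph) (l : nat) (S : {set G}) (f : G -> K) (a b : G) :
    {in S &, forall x y, dist (f x) (f y) = dist x y} ->
    is_tree G -> is_tree K -> star a S -> b \in S -> S \subset win l a b ->
  {in S, forall x, f x \in win l (f a) (f b)}.
Proof.
move=> fi Gt Kt st bS SW x xS; have aS := st.1.
have /winP[y yB yl] : x \in win l a b by exact: (subsetP SW).
have yS : y \in S by apply: (star_convex Gt st aS bS).
by apply/winP; exists (f y); rewrite !fi.
Qed.

Lemma isom_ext (G K : sgraph) (l D : nat) (S : {set G}) (f : G -> K) (a b a' b' : G) :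
    {in S &, forall x y, dist (f x) (f y) = dist x y} ->
    a \in S -> b \in S -> a' \in S -> b' \in S ->
    dist a b = D -> dist a' a = l -> dist b b' = l -> dist a' b' = D + l + l ->
  ext l D (f a) (f b).
Proof.
move=> fi aS bS a'S b'S ab aa bb E; apply/extP.
by rewrite fi //; split=> //; exists (f a'), (f b'); rewrite !fi.
Qed.

(* Each isometric copy of a window lies in exactly one window of the target. *)
Lemma win_sum (G K : sgraph) (Gt : is_tree G) (Kt : is_tree K) (l D : nat) (a b : G) :
    ext l D a b ->
  #|emb K (win l a b) a| =
  \sum_(p : K * K | ext l D p.1 p.2) nmaps (wobj Gt l a b) (wobj Kt l p.1 p.2).
Proof.
case/extP => ab [a' [b' [aa bb E]]]; have st := win_star Gt l a b.
have a'W : a' \in win l a b by apply/winP; exists a; rewrite ?distxx // aa.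
have b'W : b' \in win l a b.
  by apply/winP; exists b; rewrite ?distxx ?addn0 // (dC Gt) bb.
have bW := win_r l a b.
rewrite -sum1_card (partition_big (fun f : {ffun G -> K} => (f a, f b))
  (fun p => ext l D p.1 p.2)) /=; last first.
  by move=> f /embP[_ fi]; apply: (isom_ext fi st.1 bW a'W b'W ab aa bb E).
apply: eq_bigr => [[u v]] _ /=; rewrite sum1dep_card; apply: eq_card => f.
rewrite inE; apply/andP/omapsP => /= [[/embP[f1 fi] /eqP[fa fb]]|[f1 fi fa fb fW]].
  split=> //; first by move=> x /f1 ->.
  move=> x; have [xW|/f1 ->] := boolP (x \in win l a b); last by rewrite fa win_l.
  by rewrite -fa -fb; apply: (isom_win fi Gt Kt st bW (subxx _)).
split; last by rewrite fa fb.
by apply/embP; split=> // x /f1 ->; rewrite fa.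
Qed.

(** * The spine *)

(* The vertices [w 0, ..., w (M + 2 l)] form a longest path, of which
   [w l, ..., w (l + M)] is the spine; every vertex hangs at depth at most [l]
   on some vertex of the spine. *)
Definition coord (G : sgraph) (l M : nat) (w : nat -> G) (x : G) (i p : nat) : Prop :=
  [/\ i <= M, p <= l & forall j, j <= M -> dist x (w (j + l)) = p + ((i - j) + (j - i))].

Definition spine (G : sgraph) (l M : nat) (w : nat -> G) : Prop :=
  (forall i j, i <= M + l + l -> j <= M + l + l -> dist (w i) (w j) = (i - j) + (j - i)) /\
  (forall x, exists i p, coord l M w x i p).

Lemma geodesic_fun (G : sgraph) (a b : G) : is_tree G -> exists w : nat -> G,
  [/\ w 0 = a, w (dist a b) = b, forall i, i <= dist a b -> w i \in itv a b &
      forall i j, i <= dist a b -> j <= dist a b -> dist (w i) (w j) = (i - j) + (j - i)].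
Proof.
move=> Gt; pose w i := odflt a [pick z | (dist a z == i) && (dist z b == dist a b - i)].
have wP i : i <= dist a b -> dist a (w i) = i /\ dist (w i) b = dist a b - i.
  move=> iM; have [z [az zb]] := point Gt iM.
  rewrite /w; case: pickP => [u /andP[/eqP ? /eqP]|/(_ z)] //.
  by rewrite az zb !eqxx.
have wI i : i <= dist a b -> w i \in itv a b by move=> iM; apply/itvP; have := wP i iM; lia.
exists w; split=> //.
- by have [E _] := wP 0 isT; rewrite -(d0_eq Gt E).
- by have [_ E] := wP _ (leqnn _); apply: (d0_eq Gt); lia.
move=> i j iM jM; have [ai _] := wP i iM; have [aj _] := wP j jM.
have [le|lt] := leqP i j.
  by have := geo_line Gt (wI i iM) (wI j jM); rewrite ai aj => /(_ le); lia.
by have := geo_line Gt (wI j jM) (wI i iM); rewrite ai aj (dC Gt) => /(_ (ltnW lt)); lia.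
Qed.

(** Let [x] branch off the longest path at [w j] with height [p]. If [j] is within [l] of an end,
    maximality bounds [p] by the distance to that end, and the rest of the way to the spine is added
    to the depth. Otherwise a height above [l] would give a tripod at [w j]. *)
Lemma spine_exists (G : sgraph) (l M : nat) (a b : G) : is_tree G -> no_tripod l G ->
    dist a b = M + l + l -> (forall x y : G, dist x y <= M + l + l) ->
  exists w : nat -> G, spine l M w.
Proof.
move=> Gt nt ab dm; have dC := dC Gt; have dT := dT Gt.
have [w [w0 wN wI wd]] := geodesic_fun a b Gt; rewrite ab in wN wI wd.
have wP i : i <= M + l + l -> dist a (w i) = i /\ dist (w i) b = M + l + l - i.
  by move=> iM; rewrite -{1}w0 -wN !wd //; lia.
exists w; split=> // x.
have [m [xa xb mB]] := median Gt x a b.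
pose j := dist a m; pose p := dist x m.
have jM : j <= M + l + l by rewrite -ab /j; lia.
have mw : m = w j.
  by apply: (point_unique Gt mB); have := wP j jM; rewrite -/j; lia.
have dx i : i <= M + l + l -> dist x (w i) = p + ((i - j) + (j - i)).
  move=> iM; have [ai ib] := wP i iM; have := wd j i jM iM.
  have := dT m x (w i); have := dT (w i) x a; have := dT (w i) x b.
  by move: (dC (w i) a) (dC m a); rewrite -mw /p -/j in jM *; rewrite /j; lia.
have px := dm x b; have pa := dm x a; move: (dC m a) => ma.
have [jl|lj] := leqP j l.
  exists 0, (p + (l - j)); split=> [//||i iM]; first by rewrite /p; move: (dx l); rewrite /j in jl *; lia.
  by rewrite dx; lia.
have [Mj|jM'] := leqP (M + l) j.
  exists M, (p + (j - l - M)); split=> [//||i iM]; first by rewrite /p /j in Mj *; lia.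
  by rewrite dx; lia.
exists (j - l), p; split=> [||i iM]; [lia| |by rewrite dx; lia].
rewrite leqNgt; apply/negP => lp.
have lp' : l.+1 <= dist m x by rewrite dC.
have [z [mz zx]] := point Gt lp'.
have zd i : i <= M + l + l -> dist z (w i) = l.+1 + ((i - j) + (j - i)).
  move=> iM; have := dx i iM; have := dT z x (w i); have := dT m z (w i).
  have := wd j i jM iM; rewrite -mw.
  by move: (dC m z) (dC z x) (dC m x); rewrite -/p; lia.
apply: (nt m (w (j - l.+1)) (w (j + l.+1)) z); rewrite ?mw ?wd -?mw //; try lia.
  by rewrite dC zd; lia.
by rewrite dC zd; lia.
Qed.

Section Spine.
Variables (G : sgraph) (l M : nat) (w : nat -> G).
Hypotheses (Gt : is_tree G) (sp : spine l M w).
Implicit Types (x y a b : G).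
Local Notation v i := (w (i + l)).

Lemma spine_dist_lt x y i j p q : coord l M w x i p -> coord l M w y j q -> i < j ->
  dist x y = p + (j - i) + q.
Proof.
move=> [iM pl cx] [jM ql cy] ij.
have nij : v i != v j by rewrite -(dP Gt) sp.1; lia.
have := concat Gt (x := x) (w := y) nij; rewrite (dC Gt (v i) y) (dC Gt (v j) y).
by rewrite !cx // !cy // sp.1; lia.
Qed.

Lemma spine_dist x y i j p q : coord l M w x i p -> coord l M w y j q -> i <> j ->
  dist x y = p + ((j - i) + (i - j)) + q.
Proof.
move=> cx cy nij; have [ij|ji] := ltnP i j; first by rewrite (spine_dist_lt cx cy ij); lia.
by rewrite (dC Gt) (spine_dist_lt cy cx); lia.
Qed.

Lemma spine_coord i : i <= M -> coord l M w (v i) i 0.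
Proof. by move=> iM; split=> // j jM; rewrite sp.1; lia. Qed.

Lemma coord_unique x i j p q : coord l M w x i p -> coord l M w x j q -> i = j /\ p = q.
Proof. by move=> [iM _ ci] [jM _ cj]; have := ci i iM; have := ci j jM; rewrite !cj //; lia. Qed.

Lemma spine_same x y i p q : coord l M w x i p -> coord l M w y i q -> dist x y <= p + q.
Proof.
move=> [iM _ cx] [_ _ cy]; have := dT Gt (v i) x y.
by rewrite (dC Gt (v i)) cx // cy //; lia.
Qed.

Lemma spine_rev : spine l M (fun i => w (M + l + l - i)).
Proof.
split=> [i j iM jM|x]; first by rewrite sp.1; lia.
have [i [p [iM pl cx]]] := sp.2 x; exists (M - i), p; split=> [||j jM] //; first by lia.
have -> : M + l + l - (j + l) = (M - j) + l by lia.
by rewrite cx; lia.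
Qed.

Lemma spine_between x y z i j p q n : coord l M w x i p -> coord l M w y j q -> i < j ->
    p <= n -> n <= p + (j - i) -> dist x z = n -> dist x z + dist z y = dist x y ->
  z = v (i + n - p).
Proof.
move=> cx cy ij pn nj zn zB; apply: (point_unique Gt zB); have dxy := spine_dist_lt cx cy ij;
  case: cx cy => iM _ cx [jM _ cy].
  by rewrite dxy (dC Gt _ y) cx ?cy; lia.
by rewrite zn cx; lia.
Qed.

Lemma spine_ext_lt D a b a' b' i j p q : 0 < D ->
    dist a b = D -> dist a' a = l -> dist b b' = l -> dist a' b' = D + l + l ->
    coord l M w a' i p -> coord l M w b' j q -> i < j ->
  exists e, [/\ e + D <= M, a = v e & b = v (e + D)].
Proof.
move=> D0 ab aa bb E ca cb ij; have dE := spine_dist_lt ca cb ij.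
have [iM pl _] := ca; have [jM ql _] := cb.
have t1 := dT Gt a a' b'; have t2 := dT Gt b a b'; have t3 := dT Gt b a' b'; have t4 := dT Gt a a' b.
(* From [a'] the geodesic takes [p] steps down to the spine, leaving [l - p] steps along it until
   [a]. *)
exists (i + l - p); split; first by lia.
  by rewrite (spine_between ca cb ij (n := l) (z := a)) //; lia.
by rewrite (spine_between ca cb ij (n := l + D) (z := b)); try lia; congr w; lia.
Qed.

Lemma spine_ext D a b : 0 < D -> reflect
  (exists e, e + D <= M /\ ((a, b) = (v e, v (e + D)) \/ (a, b) = (v (e + D), v e))) (ext l D a b).
Proof.
move=> D0; have dC := dC Gt; apply: (iffP idP).
  case/extP => ab [a' [b' [aa bb E]]].
  have [i [p ca]] := sp.2 a'; have [j [q cb]] := sp.2 b'.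
  case: (ltngtP i j) => ij.
  - by have [e [eM -> ->]] := spine_ext_lt D0 ab aa bb E ca cb ij; exists e; split=> //; left.
  - have [||||e [eM -> ->]] := @spine_ext_lt D b a b' a' j i q p D0 _ _ _ _ cb ca ij; rewrite 1?dC //.
    by exists e; split=> //; right.
  - by rewrite -ij in cb; have := spine_same ca cb; case: ca cb => _ ? _ [_ ? _]; lia.
move=> [e [eM]] E; have X : ext l D (v e) (v (e + D)).
  by apply/extP; split; [|exists (w e), (w (e + D + l + l)); split]; rewrite sp.1; lia.
by case: E => -[-> ->] //; rewrite ext_sym.
Qed.

(** The window reaches only [l] beyond its segment, so it misses [M - D] vertices of the longest
    path; [g] lists them, skipping the stretch inside the window. *)
Lemma card_win_spine D a b : 0 < D -> ext l D a b -> #|win l a b| + (M - D) <= #|G|.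
Proof.
move=> D0; have dC := dC Gt; have dT := dT Gt.
have main e : e + D <= M -> #|win l (v e) (v (e + D))| + (M - D) <= #|G|.
  move=> eM; pose g (m : 'I_(M - D)) := if m < e then w m else w (m + D + l + l).+1.
  have gI : injective g.
    move=> m m' E; have mM := ltn_ord m; have mM' := ltn_ord m'; apply: val_inj => /=.
    have : dist (g m) (g m') = 0 by rewrite E distxx.
    by rewrite /g; do 2 case: ifP => ?; rewrite sp.1; lia.
  rewrite -(cardsC (win l (v e) (v (e + D)))) leq_add2l -[X in X <= _]card_ord -cardsT -(card_imset _ gI).
  apply/subset_leq_card/subsetP => _ /imsetP[m _ ->]; have mM := ltn_ord m.
  rewrite inE; apply/winP => -[y]; rewrite sp.1; try lia.
  move=> yB; have := dT y (g m) (v (e + D)); have := dT y (g m) (v e).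
  by rewrite /g; case: ifP => ?; rewrite !sp.1; move: (dC y (v e)); lia.
case/spine_ext => // e [eM [[-> ->]|[-> ->]]]; first exact: main.
have -> : win l (v (e + D)) (v e) = win l (v e) (v (e + D)); last exact: main.
by rewrite /win (itv_sym Gt).
Qed.

End Spine.

(** * Comparing the windows of two trees *)

Lemma oiso_im (X Y : obj) : oiso X Y -> exists f : og X -> og Y,
  [/\ {in oS X &, forall x y, dist (f x) (f y) = dist x y}, f (oa X) = oa Y,
      f (ob X) = ob Y & f @: oS X = oS Y].
Proof.
case/andP=> /eqP XY /card_gt0P[f /omapsP[f1 f2 fa fb fS]]; exists f; split=> //.
apply/eqP; rewrite eqEcard card_in_imset ?XY ?leqnn ?andbT; last exact: (isom_inj (og_tree X)).
by apply/subsetP => _ /imsetP[x _ ->].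
Qed.

Lemma oiso_eqset (G : sgraph) (Gt Gt' : is_tree G) (S S' : {set G}) (a b : G) aS bS aS' bS' :
  S = S' -> oiso (@Obj G S a b Gt aS bS) (@Obj G S' a b Gt' aS' bS').
Proof.
move=> SS; apply/andP; split; first by apply/eqP; congr #|pred_of_set _|.
by apply: (@nmaps_gt0 (Obj Gt aS bS) (Obj Gt' aS' bS') id) => //= x; rewrite SS.
Qed.

(* The part of a window lying in the window whose last spine vertex is [c]; it
   is computed inside [X] only, so that it is invariant under [oiso]. *)
Definition dropS (l : nat) (X : obj) (c : og X) : {set og X} :=
  [set x | [|| x == oa X, x == c | (x \in oS X) && [exists y in oS X,
     (dist (oa X) y + dist y c == dist (oa X) c) && (dist x y <= l)]]].

Lemma dropS_l l X c : oa X \in dropS l c. Proof. by rewrite inE eqxx. Qed.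
Lemma dropS_r l X (c : og X) : c \in dropS l c. Proof. by rewrite inE eqxx orbT. Qed.

Definition drop_obj (l : nat) (X : obj) (c : og X) : obj :=
  Obj (og_tree X) (dropS_l l c) (dropS_r l c).

Definition is_pred (X : obj) (c : og X) : bool :=
  (dist c (ob X) == 1) && ((dist (oa X) c).+1 == dist (oa X) (ob X)).

(** In a window the predecessor [c] is unique and the sum has one term; written as a sum it involves
    no choice and is invariant under [oiso]. *)
Definition sum_drop (l : nat) (psi : obj -> nat) (X : obj) : nat :=
  \sum_(c in oS X | is_pred c) psi (drop_obj l c).

Lemma sum_drop_oiso l (psi : obj -> nat) : (forall X Y, oiso X Y -> psi X = psi Y) ->
  forall X Y, oiso X Y -> sum_drop l psi X = sum_drop l psi Y.
Proof.
move=> hpsi X Y /oiso_im[f [fi fa fb im]]; have fI := isom_inj (og_tree X) fi.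
have fS x : x \in oS X -> f x \in oS Y by move=> xS; rewrite -im imset_f.
rewrite /sum_drop -im big_imset_cond //; apply: eq_big => [c|c /andP[cS _]].
  by case: (boolP (c \in oS X)) => //= cS; rewrite /is_pred -fa -fb !fi ?oaS ?obS.
apply: hpsi.
have dS x : x \in dropS l c -> x \in oS X /\ f x \in dropS l (f c).
  rewrite !inE => /or3P[/eqP->|/eqP->|/andP[xS /exists_inP[y yS /andP[E xy]]]].
  - by rewrite oaS fa eqxx.
  - by rewrite cS eqxx orbT.
  rewrite xS fS //; split=> //; apply/or3P/Or33/exists_inP; exists (f y); first exact: fS.
  by rewrite -fa !fi ?oaS // E.
have dE : dropS l (f c) = f @: dropS l c.
  apply/eqP; rewrite eqEsubset; apply/andP; split; apply/subsetP; last first.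
    by move=> _ /imsetP[x /dS[_ xS] ->].
  move=> z; rewrite inE => /or3P[/eqP->|/eqP->|].
  - by rewrite -fa imset_f // dropS_l.
  - by rewrite imset_f // dropS_r.
  rewrite -{1}im => /andP[/imsetP[x xS ->] /exists_inP[y']]; rewrite -{1}im => /imsetP[y yS ->].
  rewrite -fa !fi ?oaS // => E; apply: imset_f; rewrite inE xS; apply/or3P/Or33/exists_inP.
  by exists y.
rewrite /oiso /= dE card_in_imset ?eqxx /=; last by move=> x y /dS[xS _] /dS[yS _]; apply: fI.
apply: (@nmaps_gt0 (drop_obj l c) (drop_obj l (f c)) f) => //=.
  by move=> x y /dS[xS _] /dS[yS _]; apply: fi.
by move=> x /dS[].
Qed.

Lemma sum_drop_win (G : sgraph) (Gt : is_tree G) (l : nat) (psi : obj -> nat) (a b c : G) :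
    (forall X Y, oiso X Y -> psi X = psi Y) ->
    dist c b = 1 -> (dist a c).+1 = dist a b ->
  sum_drop l psi (wobj Gt l a b) = psi (wobj Gt l a c).
Proof.
move=> hpsi cb ac; have aI : c \in itv a b by apply/itvP; lia.
have winI x y : y \in itv a b -> dist x y <= l -> x \in win l a b.
  by move=> /itvP yB xy; apply/winP; exists y.
have sub y : dist a y + dist y c = dist a c -> y \in itv a b.
  by move=> E; apply/itvP; have := dT Gt c y b; have := dT Gt y a b; lia.
rewrite /sum_drop (big_pred1 c) => [|c' /=].
  apply/hpsi/oiso_eqset/setP => x; rewrite inE /=; apply/or3P/winP.
    case=> [/eqP->|/eqP->|/andP[_ /exists_inP[y _ /andP[/eqP E xy]]]].
    - by exists a; rewrite distxx.
    - by exists c; rewrite distxx ?addn0.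
    by exists y.
  move=> [y E xy]; apply: Or33; rewrite (winI x y) ?sub //=; apply/exists_inP; exists y.
    by apply: (winI y y); rewrite ?sub ?distxx.
  by rewrite E eqxx.
apply/andP/eqP => [[_ /andP[/eqP c1 /eqP c2]]|->].
  by rewrite /= in c1 c2; apply: (point_unique Gt (x := a) (y := b)); lia.
split; first by apply: (winI c c); rewrite ?distxx.
by rewrite /is_pred /= cb ac !eqxx.
Qed.

Definition windows (G : sgraph) (Gt : is_tree G) (l D : nat) : seq obj :=
  [seq wobj Gt l p.1 p.2 | p <- enum [set p : G * G | ext l D p.1 p.2]].

Lemma sum_windows_ext (G : sgraph) (Gt : is_tree G) (l D : nat) (psi : obj -> nat) :
  \sum_(X <- windows Gt l D) psi X = \sum_(p : G * G | ext l D p.1 p.2) psi (wobj Gt l p.1 p.2).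
Proof. by rewrite big_map big_enum_cond /=; apply: eq_bigl => p; rewrite inE andbT. Qed.

Lemma sum_windows (G : sgraph) (Gt : is_tree G) (l M D : nat) (w : nat -> G) (psi : obj -> nat) :
    spine l M w -> 0 < D <= M ->
  \sum_(X <- windows Gt l D) psi X =
  \sum_(0 <= e < (M - D).+1) (psi (wobj Gt l (w (e + l)) (w (e + D + l))) +
                      psi (wobj Gt l (w (e + D + l)) (w (e + l)))).
Proof.
move=> sp /andP[D0 DM]; rewrite sum_windows_ext big_mkord.
pose h (q : 'I_(M - D).+1 * bool) :=
  if q.2 then (w (q.1 + l), w (q.1 + D + l)) else (w (q.1 + D + l), w (q.1 + l)).
have winj i j : i <= M + l + l -> j <= M + l + l -> w i = w j -> i = j.
  by move=> iM jM E; have := sp.1 i j iM jM; rewrite E distxx; lia.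
have hI : injective h.
  move=> [e b] [e' b']; rewrite /h /=; have eM := ltn_ord e; have eM' := ltn_ord e'.
  case: b; case: b' => -[/winj E1 /winj E2]; congr pair; try apply: val_inj => /=; lia.
have -> : \sum_(p : G * G | ext l D p.1 p.2) psi (wobj Gt l p.1 p.2) =
          \sum_(p in h @: [set: 'I_(M - D).+1 * bool]) psi (wobj Gt l p.1 p.2).
  apply: eq_bigl => [[a b]] /=; apply/(spine_ext Gt sp a b D0)/imsetP.
    move=> [e [eM E]]; have eM' : e < (M - D).+1 by lia.
    by case: E => ->; [exists (Ordinal eM', true)|exists (Ordinal eM', false)]; rewrite ?inE.
  move=> [[e b'] _ ->]; have eM := ltn_ord e; exists e; split; first by lia.
  by rewrite /h /=; case: b'; [left|right].
rewrite big_imset /=; last by move=> ? ? _ _; exact: hI.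
rewrite (eq_bigl xpredT) => [|q]; last by rewrite inE.
rewrite -(pair_bigA _ (fun e b => psi (wobj Gt l (h (e, b)).1 (h (e, b)).2))) /=.
by apply: eq_bigr => e _; rewrite big_bool.
Qed.

(** A window read from [a] to [b] comes from a longer one exactly when the spine continues beyond
    [b]. The two exceptions are read outwards, and this is what later fixes the orientation. *)
Lemma sum_drop_windows (G : sgraph) (Gt : is_tree G) (l M D : nat) (w : nat -> G) (psi : obj -> nat) :
    (forall X Y, oiso X Y -> psi X = psi Y) -> spine l M w -> 0 < D -> D.+1 <= M ->
  \sum_(X <- windows Gt l D) psi X = \sum_(X <- windows Gt l D.+1) sum_drop l psi X +
    (psi (wobj Gt l (w (M - D + l)) (w (M + l))) + psi (wobj Gt l (w (D + l)) (w l))).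
Proof.
move=> hpsi sp D0 DM; rewrite !(sum_windows Gt _ sp) ?D0; try lia.
have -> : (M - D).+1 = (M - D.+1).+2 by lia.
rewrite [X in X = _]big_split /= big_nat_recr //= [X in _ + X = _]big_nat_recl //=.
have -> : M - D.+1 = (M - D).-1 by lia.
have -> : (M - D).-1.+1 = M - D by lia.
have -> : M - D + D + l = M + l by lia.
rewrite big_split /= !add0n.
set S1 := \sum_(_ <= _ < _) _; set S2 := \sum_(_ <= _ < _) _.
set S3 := \sum_(_ <= _ < _) _; set S4 := \sum_(_ <= _ < _) _.
suff [E1 E2] : S1 = S3 /\ S2 = S4 by rewrite E1 E2; lia.
split; apply: eq_big_nat => e eM.
  by rewrite (@sum_drop_win _ Gt l psi _ _ (w (e + D + l)) hpsi) // !sp.1; lia.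
by rewrite (@sum_drop_win _ Gt l psi _ _ (w (e.+1 + l)) hpsi) ?addSnnS // !sp.1; lia.
Qed.

Lemma oiso_inv X Y Z : oiso Y Z -> oiso X Y = oiso X Z.
Proof. by move=> YZ; rewrite oiso_sym (oiso_trans X YZ) oiso_sym. Qed.

Lemma eqv_pair X1 X2 Y1 Y2 : eqv [:: X1; X2] [:: Y1; Y2] ->
  (oiso X1 Y1 /\ oiso X2 Y2) \/ (oiso X1 Y2 /\ oiso X2 Y1).
Proof.
move=> e; have ei X : oiso X X1 + oiso X X2 = oiso X Y1 + oiso X Y2.
  have := e (fun Y => oiso X Y : nat) (fun Y Z YZ => congr1 nat_of_bool (oiso_inv X YZ)).
  by rewrite !big_cons !big_nil !addn0.
have := ei X1; have := ei X2; rewrite !oiso_refl.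
have [h e2 _|n1] := boolP (oiso X1 Y1).
  by left; split=> //; move: e2; rewrite (oiso_inv X2 h); case: (oiso X2 Y1); case: (oiso X2 Y2).
have [h e2 _|n2] := boolP (oiso X1 Y2); last by case: (oiso X1 X2).
by right; split=> //; move: e2; rewrite (oiso_inv X2 h); case: (oiso X2 Y1); case: (oiso X2 Y2).
Qed.

Lemma In_map (A : eqType) (B : Type) (f : A -> B) (X : B) (s : seq A) :
  List.In X (map f s) -> exists2 x, x \in s & X = f x.
Proof.
elim: s => //= y s IH [<-|/IH[x xs ->]]; first by exists y; rewrite ?inE ?eqxx.
by exists x; rewrite // inE xs orbT.
Qed.

Lemma In_windows (G : sgraph) (Gt : is_tree G) (l D : nat) (X : obj) :
  List.In X (windows Gt l D) -> exists a b, ext l D a b /\ X = wobj Gt l a b.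
Proof.
by move=> XI; have [[a b]] := In_map XI; rewrite mem_enum inE /= => e ->; exists a, b.
Qed.

(** The three legs of a tripod in [H] have at most [3 * l + 6] vertices together, so [T] would
    contain a copy. *)
Lemma no_tripod_transfer (T H : sgraph) (k l : nat) : is_tree T -> is_tree H ->
    (forall F : sgraph, #|F| <= k -> #|homs F T| = #|homs F H|) -> 3 * l + 6 <= k ->
  no_tripod l T -> no_tripod l H.
Proof.
move=> Tt Ht TH kl nt c z1 z2 z3 c1 c2 c3 z12 z13 z23.
pose S := itv c z1 :|: itv c z2 :|: itv c z3.
have cI z : c \in itv c z by apply/itvP; rewrite distxx.
have zI z : z \in itv c z by apply/itvP; rewrite distxx addn0.
have st : star c S by rewrite /S; apply: starU; first apply: starU; apply: itv_star.
have Sk : #|S| <= k.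
  apply: leq_trans kl; rewrite /S.
  have := cardsU (itv c z1 :|: itv c z2) (itv c z3); have := cardsU (itv c z1) (itv c z2).
  by have := card_itv Ht c z1; have := card_itv Ht c z2; have := card_itv Ht c z3; lia.
have [f fi] := transfer Ht Tt TH st Sk.
have cS : c \in S by rewrite !in_setU cI.
have z1S : z1 \in S by rewrite !in_setU zI.
have z2S : z2 \in S by rewrite !in_setU zI orbT.
have z3S : z3 \in S by rewrite !in_setU zI !orbT.
by apply: (nt (f c) (f z1) (f z2) (f z3)); rewrite fi.
Qed.

Lemma spine_card (G : sgraph) (l M : nat) (w : nat -> G) : spine l M w -> M + l + l < #|G|.
Proof.
move=> sp; pose g (i : 'I_(M + l + l).+1) := w i.
have gI : injective g.
  move=> i j E; have iM := ltn_ord i; have jM := ltn_ord j; apply: val_inj => /=.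
  by have := sp.1 i j; rewrite -/(g i) -/(g j) E distxx; lia.
by have := max_card (g @: setT); rewrite card_imset // cardsT card_ord.
Qed.

Section Ends.
Variables (T H : sgraph) (k l M : nat) (w : nat -> T).
Hypotheses (Tt : is_tree T) (Ht : is_tree H) (sp : spine l M w).
Hypothesis TH : forall F : sgraph, #|F| <= k -> #|homs F H| = #|homs F T|.
Hypotheses (Tn : #|T| = k + l) (Mk : M + l < k) (Ml : l + 4 <= M) (Hnt : no_tripod l H).

Let TH' (F : sgraph) : #|F| <= k -> #|homs F T| = #|homs F H|.
Proof. by move=> /TH. Qed.

Lemma window_lt D a b : 0 < D -> D + l < M -> ext l D (a : T) b -> #|win l a b| < k.
Proof. by move=> D0 DM e; have := card_win_spine Tt sp D0 e; lia. Qed.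

(* A window of [H] with at least [k] vertices would contain a [k]-vertex
   subtree, whose copy in [T] lies in a window that is too small. *)
Lemma window_lt_H D a b : 0 < D -> D + l < M -> ext l D (a : H) b -> #|win l a b| < k.
Proof.
move=> D0 DM; case/extP => ab [a' [b' [aa bb E]]]; rewrite ltnNge; apply/negP => kw.
have dT := dT Ht; have dC := dC Ht.
have aI : a \in itv a' b' by apply/itvP; have := dT a a' b'; have := dT b a b'; lia.
have bI : b \in itv a' b' by apply/itvP; have := dT b a' b'; have := dT a a' b; lia.
have sub : itv a' b' \subset win l a b.
  apply/subsetP => y yI; apply/winP.
  have [h|h] := leqP (dist a' y) (dist a' a).
    exists a; first by rewrite distxx.
    by have := geo_line Ht yI aI h; lia.
  have [h'|h'] := leqP (dist a' y) (dist a' b).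
    exists y; last by rewrite distxx.
    have := geo_line Ht aI yI (ltnW h); have := geo_line Ht yI bI h'.
    by have := geo_line Ht aI bI; have := dT b a' b'; have := dT a a' b; move/itvP: bI; move/itvP: aI; lia.
  exists b; first by rewrite distxx addn0.
  by have := geo_line Ht bI yI (ltnW h'); move/itvP: bI; move/itvP: yI; move: (dC b y); lia.
have sz : #|itv a' b'| <= k <= #|win l a b|.
  by rewrite kw andbT (leq_trans (card_itv Ht _ _)) // E; lia.
have [S [st IS SW Sk]] := grow (itv_star Ht aI) (win_star Ht l a b) sub sz.
have Sk' : #|S| <= k by rewrite Sk.
have [f fi] := transfer Ht Tt TH' st Sk'.
have a'S : a' \in S by apply: (subsetP IS); apply/itvP; rewrite distxx.
have b'S : b' \in S by apply: (subsetP IS); apply/itvP; rewrite distxx addn0.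
have bS := subsetP IS _ bI.
have e := isom_ext fi st.1 bS a'S b'S ab aa bb E.
have := window_lt D0 DM e; rewrite ltnNge => /negP; apply.
rewrite -Sk -(card_in_imset (isom_inj Ht fi)); apply/subset_leq_card/subsetP => _ /imsetP[x xS ->].
exact: (isom_win fi Ht Tt st bS SW).
Qed.

(** The deck counts the copies of each window, and [win_sum] distributes them over the windows of
    the target; this is the system of equations that [triangular] solves. *)
Lemma windows_eqv D : 0 < D -> D + l < M -> eqv (windows Tt l D) (windows Ht l D).
Proof.
move=> D0 DM; apply: triangular => X XI; left.
have main (G : sgraph) (Gt : is_tree G) (a b : G) : ext l D a b -> #|win l a b| < k ->
    \sum_(Y <- windows Tt l D) nmaps (wobj Gt l a b) Y = \sum_(Y <- windows Ht l D) nmaps (wobj Gt l a b) Y.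
  move=> e lt; rewrite !sum_windows_ext -(win_sum Gt Tt e) -(win_sum Gt Ht e).
  by apply: (emb_deck Tt Ht TH Gt (win_star Gt l a b)); apply: ltnW.
case: (List.in_app_or _ _ _ XI) => /In_windows [a [b [e ->]]]; apply: main => //.
  exact: window_lt e.
exact: window_lt_H e.
Qed.

(** The whole longest path of [T] may exceed [k] vertices, but without its last [l.+1] it has a copy
    in [H]. This bounds the diameter of [H] from below, and a pair at maximal distance yields a
    spine. *)
Lemma spine_H_exists : exists M' (w' : nat -> H), spine l M' w' /\ M - l.+1 <= M'.
Proof.
have wI i : i <= M + l + l -> w i \in itv (w 0) (w (M + l + l)).
  by move=> iM; apply/itvP; rewrite !sp.1; lia.
pose N := M - l.+1 + l + l.
have st : star (w 0) (itv (w 0) (w N)) by apply: itv_star => //; apply/itvP; rewrite distxx.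
have Nk : #|itv (w 0) (w N)| <= k.
  by apply: leq_trans (card_itv Tt _ _) _; rewrite sp.1 /N; lia.
have [f fi] := transfer Tt Ht TH st Nk.
have fN : dist (f (w 0)) (f (w N)) = N.
  rewrite fi ?sp.1 /N; try lia; apply/itvP; rewrite distxx ?addn0; lia.
case: (@arg_maxnP _ (f (w 0), f (w N)) xpredT (fun p : H * H => dist p.1 p.2) isT) => -[a b] _ /= abm.
have Nab : N <= dist a b by rewrite -fN; apply: (abm (f (w 0), f (w N)) isT).
pose M' := dist a b - l - l.
have ab : dist a b = M' + l + l by rewrite /M'; move: Nab; rewrite /N; lia.
have mx (x y : H) : dist x y <= M' + l + l by rewrite -ab; apply: (abm (x, y) isT).
have [w' sp'] := spine_exists Ht Hnt ab mx.
by exists M', w'; split=> //; move: Nab; rewrite ab /N; lia.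
Qed.

(* Dropping the last spine vertex of all windows of spine length [D.+1], read
   in both directions, yields all windows of spine length [D] except the two
   that end at an end of the spine. *)
Lemma end_windows : exists w' : nat -> H, let D := M - l.+2 in
  [/\ spine l M w',
      oiso (wobj Tt l (w (l.+2 + l)) (w (M + l))) (wobj Ht l (w' (l.+2 + l)) (w' (M + l))) &
      oiso (wobj Tt l (w (D + l)) (w l)) (wobj Ht l (w' (D + l)) (w' l))].
Proof.
have [M' [w' [sp' MM']]] := spine_H_exists; set D := M - l.+2.
have D1 : D.+1 = M - l.+1 by rewrite /D; lia.
have eD : eqv (windows Tt l D) (windows Ht l D) by apply: windows_eqv; rewrite /D; lia.
have eD1 : eqv (windows Tt l D.+1) (windows Ht l D.+1) by apply: windows_eqv; rewrite /D; lia.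
(* Both spines have equally many segments of length [M - l.+1], which determines [M']. *)
have {MM'} E : M' = M.
  have := eD1 (fun=> 1) (fun _ _ _ => erefl).
  rewrite (sum_windows Tt _ sp); last by rewrite /D; lia.
  rewrite (sum_windows Ht _ sp'); last by rewrite /D; lia.
  by rewrite !sum_nat_const_nat; rewrite /D; lia.
rewrite E in sp'.
have e2 : eqv [:: wobj Tt l (w (l.+2 + l)) (w (M + l)); wobj Tt l (w (D + l)) (w l)]
              [:: wobj Ht l (w' (l.+2 + l)) (w' (M + l)); wobj Ht l (w' (D + l)) (w' l)].
  move=> psi hpsi; have := eD psi hpsi; rewrite !big_cons !big_nil !addn0.
  have MD : M - D = l.+2 by rewrite /D; lia.
  rewrite (sum_drop_windows Tt hpsi sp) ?(sum_drop_windows Ht hpsi sp'); try by rewrite /D; lia.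
  by rewrite (eD1 _ (sum_drop_oiso l hpsi)) MD => /addnI.
case: (eqv_pair e2) => -[h1 h2]; first by exists w'.
(* The end windows match crosswise, so the spine of [H] is read backwards. *)
have := spine_rev sp'; set w'' := fun i => _ => sp''; exists w''; split=> //.
  have -> : w'' (l.+2 + l) = w' (D + l) by rewrite /w'' /D; congr w'; lia.
  by have -> : w'' (M + l) = w' l by rewrite /w''; congr w'; lia.
have -> : w'' (D + l) = w' (l.+2 + l) by rewrite /w'' /D; congr w'; lia.
by have -> : w'' l = w' (M + l) by rewrite /w''; congr w'; lia.
Qed.

End Ends.

(** * Letters *)

Lemma oiso_nmaps X Y : oiso X Y = (0 < nmaps X Y) && (0 < nmaps Y X).
Proof.
apply/idP/andP => [h|[h1 h2]]; first by rewrite (nmaps_inv h); case/andP: h.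
by rewrite /oiso h1 eqn_leq !nmaps_card.
Qed.

Lemma oiso_eq (G : sgraph) (Gt Gt' : is_tree G) (S S' : {set G}) (a a' b b' : G) aS bS aS' bS' :
  S = S' -> a = a' -> b = b' -> oiso (@Obj G S a b Gt aS bS) (@Obj G S' a' b' Gt' aS' bS').
Proof. by move=> SS aa bb; subst; apply: oiso_eqset. Qed.

(* For [i <= M], the vertices whose nearest spine vertex is [w (i + l)]; the
   first disjunct only makes [letter_root] hold for all [i]. *)
Definition letter (G : sgraph) (l M : nat) (w : nat -> G) (i : nat) : {set G} :=
  [set x | (x == w (i + l)) ||
    [forall j : 'I_M.+1, dist x (w (j + l)) == dist x (w (i + l)) + ((i - j) + (j - i))]].

Lemma letter_root (G : sgraph) (l M : nat) (w : nat -> G) (i : nat) : w (i + l) \in letter l M w i.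
Proof. by rewrite inE eqxx. Qed.

Definition lobj (G : sgraph) (Gt : is_tree G) (l M : nat) (w : nat -> G) (i : nat) : obj :=
  Obj Gt (letter_root l M w i) (letter_root l M w i).

Section Letters.
Variables (G : sgraph) (l M : nat) (w : nat -> G).
Hypotheses (Gt : is_tree G) (sp : spine l M w).
Implicit Types (x y : G).
Local Notation v i := (w (i + l)).

Lemma letterP x i : i <= M -> reflect (exists p, coord l M w x i p) (x \in letter l M w i).
Proof.
move=> iM; rewrite inE; apply: (iffP orP) => [[/eqP->|/forallP h]|[p cx]].
- by exists 0; apply: spine_coord.
- have [i' [p' [iM' pl' cx']]] := sp.2 x.
  have hj j : j <= M -> dist x (v j) = dist x (v i) + ((i - j) + (j - i)).
    by move=> jM; have jM1 : j < M.+1 by []; apply/eqP; apply: (h (Ordinal jM1)).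
  have E : i' = i by have := hj i' iM'; have := hj i iM; rewrite !cx' //; lia.
  by rewrite E in cx'; exists p'.
right; apply/forallP => j; have jM := ltn_ord j; case: cx => _ _ cx.
by rewrite !cx //; lia.
Qed.

Lemma letter_dist x i j : i <= M -> j <= M -> x \in letter l M w i ->
  dist x (v j) = dist x (v i) + ((i - j) + (j - i)).
Proof. by move=> iM jM /letterP-/(_ iM) [p [_ _ cx]]; rewrite !cx //; lia. Qed.

Lemma letter_coord x i : i <= M -> x \in letter l M w i -> coord l M w x i (dist x (v i)).
Proof.
move=> iM /letterP-/(_ iM) [p cx]; have [_ _ /(_ i iM) E] := cx.
by rewrite (_ : dist x (v i) = p) //; lia.
Qed.

Lemma letter_unique x i j : i <= M -> j <= M -> x \in letter l M w i -> x \in letter l M w j -> i = j.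
Proof. by move=> iM jM /letterP-/(_ iM)[p c] /letterP-/(_ jM)[q c']; case: (coord_unique c c'). Qed.

Lemma letter_exists x : exists2 i, i <= M & x \in letter l M w i.
Proof. by have [i [p cx]] := sp.2 x; have [iM _ _] := cx; exists i => //; apply/letterP => //; exists p. Qed.

Lemma letter_star i : i <= M -> star (v i) (letter l M w i).
Proof.
move=> iM; split=> [|x xL nx]; first exact: letter_root.
rewrite eq_sym in nx; have [u [e du]] := d_step Gt nx; exists u; split=> //.
have [j jM uL] := letter_exists u.
have ux : dist u x = 1 by apply/eqP; rewrite (d1 Gt).
have [<- //|/eqP ij] := eqVneq j i.
have := spine_dist Gt sp (letter_coord jM uL) (letter_coord iM xL) ij.
have x0 : 0 < dist (v i) x by rewrite lt0n (dP Gt).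
by move: (dC Gt x (v i)); lia.
Qed.

Lemma letter_rev i : i <= M -> letter l M (fun j => w (M + l + l - j)) i = letter l M w (M - i).
Proof.
move=> iM.
have E j : j <= M -> w (M + l + l - (j + l)) = w (M - j + l) by move=> jM; congr w; lia.
apply/setP => x; rewrite !inE E //; congr orb; apply/forallP/forallP => h j.
  have jM := ltn_ord j; have jM1 : M - j < M.+1 by lia.
  have jE : M - (M - j) = j by lia.
  have := h (Ordinal jM1); rewrite /= E ?jE; [lia|exact: leq_subr].
have jM := ltn_ord j; have jM1 : M - j < M.+1 by lia.
have := h (Ordinal jM1); rewrite /= E; [lia|by rewrite -ltnS].
Qed.

End Letters.

Lemma lobj_rev (G : sgraph) (Gt : is_tree G) (l M : nat) (w : nat -> G) i : i <= M ->
  oiso (lobj Gt l M (fun j => w (M + l + l - j)) i) (lobj Gt l M w (M - i)).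
Proof.
move=> iM; have Ei : w (M + l + l - (i + l)) = w (M - i + l).
  by have -> : M + l + l - (i + l) = M - i + l by lia.
exact: (oiso_eq _ _ _ _ _ _ (letter_rev l w iM) Ei Ei).
Qed.

Section Gluing.
Variables (T H : sgraph) (l M : nat) (w : nat -> T) (u : nat -> H).
Hypotheses (Tt : is_tree T) (Ht : is_tree H) (sp : spine l M w) (spu : spine l M u).
Local Notation L i := (lobj Tt l M w i).
Local Notation L' i := (lobj Ht l M u i).

(** Each vertex is moved by the isomorphism of its own letter. Distances across letters depend only
    on positions and depths, so the union of these maps is isometric. *)
Lemma glue : #|T| = #|H| -> (forall i, i <= M -> oiso (L i) (L' i)) -> iso H T.
Proof.
move=> TH h.
pose F i : {ffun T -> H} := odflt [ffun=> u 0] [pick f in omaps (L i) (L' i)].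
have FP i : i <= M -> F i \in omaps (L i) (L' i).
  move=> iM; rewrite /F; case: pickP => [f //|none]; have /andP[_ /card_gt0P[f]] := h i iM.
  by rewrite none.
pose idx x : nat := odflt ord0 [pick i : 'I_M.+1 | x \in letter l M w i].
have idxP x : idx x <= M /\ x \in letter l M w (idx x).
  have [i iM xL] := letter_exists sp x; have iM1 : i < M.+1 by [].
  rewrite /idx; case: pickP => [j xj|/(_ (Ordinal iM1))]; last by rewrite /= xL.
  by have := ltn_ord j.
pose g x := F (idx x) x.
have gc x : coord l M u (g x) (idx x) (dist x (w (idx x + l))).
  have [iM xL] := idxP x; have /omapsP[_ fi fa _ fS] := FP _ iM.
  have := letter_coord spu iM (fS x); congr (coord _ _ _ _ _ _).
  by rewrite -[u (idx x + l)]fa fi // letter_root.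
have gi x y : dist (g x) (g y) = dist x y.
  have [iM xL] := idxP x; have [jM yL] := idxP y.
  have [E|/eqP ij] := eqVneq (idx x) (idx y).
    rewrite /g -E; have /omapsP[_ fi _ _ _] := FP _ iM; apply: fi => //=.
    by rewrite E.
  rewrite (spine_dist Ht spu (gc x) (gc y) ij).
  by rewrite (spine_dist Tt sp (letter_coord sp iM xL) (letter_coord sp jM yL) ij).
have gI : injective g by move=> x y E; apply: (d0_eq Tt); rewrite -gi E distxx.
have gE x y : edge (g x) (g y) = edge x y by rewrite -(d1 Ht) gi (d1 Tt).
have [g' gK g'K] : bijective g by apply: inj_card_bij => //; rewrite TH.
by exists g' => [|x y]; [exists g|rewrite -gE !g'K].
Qed.

(** The isomorphism fixes the ends of the segment and hence every spine vertex on it. Distances to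
    the spine vertices at [i.-1], [i] and [M] then recognize the letter at [i]; for [i.-1] to lie in
    the window, [a < i] is required. *)
Lemma letter_of_window_le a i : a < i <= M ->
    oiso (wobj Tt l (w (a + l)) (w (M + l))) (wobj Ht l (u (a + l)) (u (M + l))) ->
  0 < nmaps (L i) (L' i).
Proof.
move=> /andP[ai iM] /oiso_im[f /= [fi fa fM im]].
have vI j : a <= j -> j <= M -> w (j + l) \in itv (w (a + l)) (w (M + l)).
  by move=> aj jM; apply/itvP; rewrite !sp.1; lia.
have vW j : a <= j -> j <= M -> w (j + l) \in win l (w (a + l)) (w (M + l)).
  by move=> aj jM; apply/winP; exists (w (j + l)); rewrite ?distxx //; apply/itvP/vI.
have fv j : a <= j -> j <= M -> f (w (j + l)) = u (j + l).
  move=> aj jM; have jW := vW j aj jM.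
  have aM : a <= M by lia.
  have aW := vW a (leqnn a) aM; have MW := vW M aM (leqnn M).
  have d1 : dist (u (a + l)) (f (w (j + l))) = j - a by rewrite -fa fi // sp.1; lia.
  have d2 : dist (f (w (j + l))) (u (M + l)) = M - j by rewrite -fM fi // sp.1; lia.
  apply: (point_unique Ht (x := u (a + l)) (y := u (M + l))); rewrite ?d1 ?d2 !spu.1; lia.
have LW x : x \in letter l M w i -> x \in win l (w (a + l)) (w (M + l)).
  move=> xL; apply/winP; exists (w (i + l)); first by apply/itvP/vI; lia.
  by case: (letter_coord sp iM xL).
apply: (@nmaps_gt0 (L i) (L' i) f) => /=.
- by move=> x y /LW xW /LW yW; apply: fi.
- by apply: fv; lia.
- by apply: fv; lia.
move=> x xL; have xW := LW x xL; have [_ _ cx] := letter_coord sp iM xL.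
have fx j : a <= j -> j <= M -> dist (f x) (u (j + l)) = dist x (w (i + l)) + ((i - j) + (j - i)).
  by move=> aj jM; rewrite -(fv j aj jM) fi ?vW // cx.
have [i' [p' c']] := spu.2 (f x); have [iM' _ cf] := c'.
have i1 : a <= i.-1 by lia.
have i2 : i.-1 <= M by lia.
have E : i' = i.
  have := fx i (ltnW ai) iM; have := fx M (leq_trans (ltnW ai) iM) (leqnn M).
  by have := fx i.-1 i1 i2; rewrite !cf; lia.
by rewrite E in c'; apply/letterP => //; exists p'.
Qed.
End Gluing.

Lemma letter_of_window (T H : sgraph) (Tt : is_tree T) (Ht : is_tree H) (l M : nat)
    (w : nat -> T) (u : nat -> H) a i : spine l M w -> spine l M u -> a < i <= M ->
    oiso (wobj Tt l (w (a + l)) (w (M + l))) (wobj Ht l (u (a + l)) (u (M + l))) ->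
  oiso (lobj Tt l M w i) (lobj Ht l M u i).
Proof.
move=> sp spu aiM h; rewrite oiso_nmaps (letter_of_window_le sp spu aiM h).
by rewrite oiso_sym in h; rewrite (letter_of_window_le spu sp aiM h).
Qed.

Section EndLetters.
Variables (T H : sgraph) (k l M : nat) (w : nat -> T).
Hypotheses (Tt : is_tree T) (Ht : is_tree H) (sp : spine l M w).
Hypothesis TH : forall F : sgraph, #|F| <= k -> #|homs F H| = #|homs F T|.
Hypotheses (Tn : #|T| = k + l) (Mk : M + l < k) (Ml : l + 4 <= M) (Hnt : no_tripod l H).

Lemma end_letters : exists u : nat -> H, spine l M u /\
  forall i, i <= M -> (l.+2 < i \/ i + l.+2 < M) -> oiso (lobj Tt l M w i) (lobj Ht l M u i).
Proof.
have [u [spu h1 h2]] := end_windows Tt Ht sp TH Tn Mk Ml Hnt.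
exists u; split=> // i iM [li|lM].
  by apply: letter_of_window sp spu _ h1; rewrite li.
have spr := spine_rev sp; have spur := spine_rev spu.
have ri : l.+2 < M - i <= M by lia.
have := @letter_of_window _ _ Tt Ht _ _ _ _ _ _ spr spur ri.
have -> : M + l + l - (l.+2 + l) = M - l.+2 + l by lia.
have -> : M + l + l - (M + l) = l by lia.
move=> /(_ h2); have iM' : M - i <= M by lia.
have MM : M - (M - i) = i by lia.
have := lobj_rev Tt l w iM'; have := lobj_rev Ht l u iM'; rewrite MM => r1 r2 r.
by rewrite -(oiso_trans _ r2) -(oiso_inv _ r1).
Qed.
End EndLetters.

(** * Counting maps of a longest path *)

Definition trunk (G : sgraph) (l M : nat) (w : nat -> G) : {set G} := itv (w 0) (w (M + l + l)).

(* [(a, b)] are the ends of a longest path running in the direction of [u]. *)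
Definition straight (G : sgraph) (l M : nat) (u : nat -> G) (p : G * G) : bool :=
  (dist p.1 (u (M + l)) == M + l) && (dist p.2 (u l) == M + l).

Section Trunk.
Variables (G : sgraph) (l M : nat) (w : nat -> G).
Hypotheses (Gt : is_tree G) (sp : spine l M w).
Local Notation P := (trunk l M w).
Local Notation v i := (w (i + l)).

Lemma trunkP x : reflect (exists2 i, i <= M + l + l & x = w i) (x \in P).
Proof.
apply: (iffP (itvP _ _ _)) => [xB|[i iM ->]]; last by rewrite !sp.1; lia.
have dN : dist (w 0) (w (M + l + l)) = M + l + l by rewrite sp.1; lia.
have iM : dist (w 0) x <= M + l + l by lia.
exists (dist (w 0) x) => //.
by apply: (point_unique Gt xB); rewrite !sp.1; lia.
Qed.

Lemma trunk_w i : i <= M + l + l -> w i \in P.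
Proof. by move=> iM; apply/trunkP; exists i. Qed.

Lemma trunk_star x : x \in P -> star x P.
Proof. exact: itv_star. Qed.

Lemma card_trunk : #|P| <= (M + l + l).+1.
Proof. by apply: leq_trans (card_itv Gt _ _) _; rewrite sp.1; lia. Qed.

Lemma trunk_rev : trunk l M (fun i => w (M + l + l - i)) = P.
Proof. by rewrite /trunk subn0 subnn itv_sym. Qed.

(** Truncated subtraction and [minn] clamp the position to the spine; the two outer stretches of
    length [l] belong to the end letters. *)
Lemma trunk_coord i : i <= M + l + l ->
  coord l M w (w i) (minn M (i - l)) ((i - l - minn M (i - l)) + (l - i)).
Proof. by move=> iM; split=> [||j jM]; [lia|lia|rewrite sp.1; lia]. Qed.

Lemma trunk_letter i j : i <= M + l + l -> j <= M -> (w i \in letter l M w j) = (minn M (i - l) == j).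
Proof.
move=> iM jM; have ci := trunk_coord iM; apply/(letterP sp _ jM)/eqP => [[p cj]|<-].
  by case: (coord_unique ci cj).
by eexists; apply: ci.
Qed.

Lemma letter_trunk_dist x t i : 0 < t < M -> i <= M + l + l -> x \in letter l M w t ->
  dist x (w i) = dist x (v t) + ((i - (t + l)) + (t + l - i)).
Proof.
move=> tM iM xL; have tM' : t <= M by lia.
have cx := letter_coord sp tM' xL; have ci := trunk_coord iM.
have [->|/eqP nit] := eqVneq i (t + l); first by lia.
by rewrite (spine_dist Gt sp cx ci); lia.
Qed.

Lemma trunk_star_letter (A : {set G}) i j : i <= M -> j <= M -> A \subset letter l M w i ->
  star (v i) A -> star (v j) (P :|: A).
Proof.
move=> iM jM /subsetP AL stA.
have vP h : h <= M -> v h \in P by move=> hM; apply: trunk_w; lia.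
have stP := trunk_star (vP j jM).
split=> [|x]; first by rewrite inE stP.1.
rewrite inE => /orP[xP|xA] nx.
  by have [y [yP e dy]] := stP.2 x xP nx; exists y; rewrite inE yP.
have [xi|nxi] := eqVneq x (v i).
  have xP : x \in P by rewrite xi vP.
  by have [y [yP e dy]] := stP.2 x xP nx; exists y; rewrite inE yP.
have [y [yA e dy]] := stA.2 x xA nxi; exists y; split=> //; first by rewrite inE yA orbT.
have := letter_dist sp iM jM (AL x xA); have := letter_dist sp iM jM (AL y yA).
by move: (dC Gt x (v i)) (dC Gt y (v i)) (dC Gt x (v j)) (dC Gt y (v j)); lia.
Qed.

Lemma straight_coord a b : straight l M w (a, b) -> coord l M w a 0 l /\ coord l M w b M l.
Proof.
case/andP=> /eqP /= aM /eqP b0.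
have [i [p ca]] := sp.2 a; have [j [q cb]] := sp.2 b.
have [iM pl ca'] := ca; have [jM ql cb'] := cb.
have := ca' M (leqnn M); have := cb' 0 (leq0n M); rewrite add0n b0 aM => E1 E2.
have [i0 pE] : i = 0 /\ p = l by lia.
have [j0 qE] : j = M /\ q = l by lia.
by rewrite i0 pE in ca; rewrite j0 qE in cb.
Qed.

Lemma coord_straight a b : coord l M w a 0 l -> coord l M w b M l -> straight l M w (a, b).
Proof.
move=> [_ _ ca] [_ _ cb]; apply/andP; split=> /=; apply/eqP; first by rewrite ca //; lia.
by have := cb 0 (leq0n M); rewrite add0n => ->; lia.
Qed.

Lemma straight_ends : straight l M w (w 0, w (M + l + l)).
Proof. by apply/andP; split=> /=; apply/eqP; rewrite sp.1; lia. Qed.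

(** All longest paths share the spine, so the one between [a] and [b] can replace the reference
    path. *)
Lemma straight_spine a b : 0 < M -> straight l M w (a, b) -> exists u : nat -> G,
  [/\ spine l M u, u 0 = a, u (M + l + l) = b & forall i, i <= M -> u (i + l) = v i].
Proof.
move=> M0 /straight_coord[ca cb]; have ab := spine_dist_lt Gt sp ca cb M0.
have [u [u0 uN uI ud]] := geodesic_fun a b Gt; rewrite ab in uN uI ud.
have NE : M + l + l = l + (M - 0) + l by lia.
have uE i : i <= M -> u (i + l) = v i.
  move=> iM; have iN : i + l <= l + (M - 0) + l by lia.
  have ci := spine_coord sp iM; have := ud 0 (i + l) isT iN; rewrite u0 => di.
  have [_ _ da] := ca; have [_ _ db] := cb.
  apply: (point_unique Gt (x := a) (y := b)); first by apply/itvP/uI.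
    by rewrite da // (dC Gt) db // ab; lia.
  by rewrite da //; lia.
exists u; split=> //; rewrite ?NE //; split=> [i j iM jM|x]; first by apply: ud; lia.
have [i [p [iM pl cx]]] := sp.2 x; exists i, p; split=> // j jM.
by rewrite uE // cx.
Qed.
End Trunk.

Section Embeddings.
Variables (G K : sgraph) (l M : nat) (w : nat -> G) (u : nat -> K).
Hypotheses (Gt : is_tree G) (Kt : is_tree K) (sp : spine l M w) (spu : spine l M u) (M0 : 0 < M).
Local Notation P := (trunk l M w).
Local Notation N := (M + l + l).

(** Depths are at most [l], so two vertices at distance [M + l + l] must have depth [l] over
    opposite ends of the spine. *)
Lemma isom_trunk (S : {set G}) (f : G -> K) :
    {in S &, forall x y, dist (f x) (f y) = dist x y} -> P \subset S ->
  straight l M u (f (w 0), f (w N)) \/ straight l M u (f (w N), f (w 0)).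
Proof.
move=> fi /subsetP PS; have wS i : i <= N -> w i \in S by move=> iM; apply/PS/trunk_w.
have [i [p ca]] := spu.2 (f (w 0)); have [j [q cb]] := spu.2 (f (w N)).
have dN : dist (f (w 0)) (f (w N)) = N by rewrite fi ?wS // sp.1; lia.
have [ij|/eqP ij] := eqVneq i j.
  by rewrite -ij in cb; have := spine_same Kt ca cb; case: ca cb => _ ? _ [_ ? _]; lia.
have := spine_dist Kt spu ca cb ij; rewrite dN => E.
have [pE qE] : p = l /\ q = l by case: ca cb => ? ? _ [? ? _]; lia.
have [[iE jE]|[iE jE]] : (i = 0 /\ j = M) \/ (i = M /\ j = 0) by case: ca cb => ? ? _ [? ? _]; lia.
  by left; rewrite pE iE in ca; rewrite qE jE in cb; apply: coord_straight.
by right; rewrite pE iE in ca; rewrite qE jE in cb; apply: coord_straight.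
Qed.

Lemma straight_isom (S : {set G}) (f : G -> K) i :
    {in S &, forall x y, dist (f x) (f y) = dist x y} -> P \subset S ->
    straight l M u (f (w 0), f (w N)) -> i <= M -> f (w (i + l)) = u (i + l).
Proof.
move=> fi /subsetP PS st iM; have wS j : j <= N -> w j \in S by move=> jM; apply/PS/trunk_w.
have [[_ _ ca] [_ _ cb]] := straight_coord spu st.
have iN : w (i + l) \in S by apply: wS; lia.
have S0 : w 0 \in S by apply: wS.
have SN : w N \in S by apply: wS.
apply: (point_unique Kt (x := f (w 0)) (y := f (w N))).
- by rewrite !fi // !sp.1; lia.
- by rewrite ca // (dC Kt) cb // fi // sp.1; lia.
- by rewrite ca // fi // sp.1; lia.
Qed.

Lemma trunk_isom_eq (S : {set G}) (f g : G -> K) i :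
    {in S &, forall x y, dist (f x) (f y) = dist x y} ->
    {in S &, forall x y, dist (g x) (g y) = dist x y} -> P \subset S ->
    f (w 0) = g (w 0) -> f (w N) = g (w N) -> i <= N -> f (w i) = g (w i).
Proof.
move=> fi gi /subsetP PS E0 EN iN; have wS j : j <= N -> w j \in S by move=> jM; apply/PS/trunk_w.
have S0 : w 0 \in S by apply: wS.
have SN : w N \in S by apply: wS.
have iS := wS i iN.
have d1 : dist (w 0) (w i) = i by rewrite sp.1; lia.
have d2 : dist (w i) (w N) = N - i by rewrite sp.1; lia.
have d3 : dist (w 0) (w N) = N by rewrite sp.1; lia.
apply: (point_unique Kt (x := f (w 0)) (y := f (w N))).
- by rewrite (fi _ _ S0 iS) (fi _ _ iS SN) (fi _ _ S0 SN) d1 d2 d3 subnKC.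
- by rewrite E0 EN (gi _ _ S0 iS) (gi _ _ iS SN) (gi _ _ S0 SN) d1 d2 d3 subnKC.
- by rewrite (fi _ _ S0 iS) E0 (gi _ _ S0 iS).
Qed.

Lemma straight_letter (S : {set G}) (f : G -> K) i x :
    {in S &, forall x y, dist (f x) (f y) = dist x y} -> P \subset S ->
    straight l M u (f (w 0), f (w N)) -> i <= M -> x \in S -> x \in letter l M w i ->
  f x \in letter l M u i.
Proof.
move=> fi PS st iM xS xL; apply/(letterP spu _ iM).
exists (dist x (w (i + l))); have [_ pl cx] := letter_coord sp iM xL; split=> // j jM.
have jS : w (j + l) \in S by apply/(subsetP PS)/trunk_w; last lia.
by rewrite -(straight_isom fi PS st jM) (fi _ _ xS jS) cx.
Qed.

Lemma straight_nmaps (S A : {set G}) (f : G -> K) c i (cA : c \in A) :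
    {in S &, forall x y, dist (f x) (f y) = dist x y} -> P \subset S ->
    straight l M u (f (w 0), f (w N)) -> i <= M -> A \subset S -> A \subset letter l M w i ->
    c = w (i + l) -> 
  0 < nmaps (Obj Gt cA cA) (lobj Kt l M u i).
Proof.
move=> fi PS st iM /subsetP AS /subsetP AL cE; apply: (@nmaps_gt0 (Obj Gt cA cA) (lobj Kt l M u i) f) => /=.
- by move=> x y /AS xS /AS yS; apply: fi.
- by rewrite cE; apply: (straight_isom fi PS st iM).
- by rewrite cE; apply: (straight_isom fi PS st iM).
- by move=> x xA; apply: (straight_letter fi PS st iM (AS x xA) (AL x xA)).
Qed.

Section Count.
Variables (t : nat) (c : G) (A : {set G}) (cA : c \in A).
Hypotheses (tM : 0 < t < M) (cE : c = w (t + l)) (AL : A \subset letter l M w t).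

Let tM' : t <= M. Proof. lia. Qed.
Let PA : {set G} := P :|: A.
Let D : {set {ffun G -> K}} := [set f in emb K PA c | straight l M u (f (w 0), f (w N))].
Let X : obj := Obj Gt cA cA.

(** A straight copy is the same as a choice of the ends of the image path and, independently, a map
    of [A] into the letter: as [0 < t < M], the path meets [A] only in its root, and distances from
    a letter vertex to the path depend only on its depth. *)
Lemma count_straight : #|D| = #|[set p | straight l M u p]| * nmaps X (lobj Kt l M u t).
Proof.
have PS : P \subset PA by apply: subsetUl.
have AS : A \subset PA by apply: subsetUr.
have wP i : i <= N -> w i \in P by apply: trunk_w.
have wA i : i <= N -> w i \in A -> i = t + l.
  move=> iN /(subsetP AL); rewrite (trunk_letter sp iN tM') => /eqP; lia.
pose rest (f : {ffun G -> K}) : {ffun G -> K} := [ffun x => if x \in A then f x else f c].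
pose th (f : {ffun G -> K}) := ((f (w 0), f (w N)), rest f).
have DP f : f \in D -> [/\ forall x, x \notin PA -> f x = f c,
    {in PA &, forall x y, dist (f x) (f y) = dist x y} & straight l M u (f (w 0), f (w N))].
  by rewrite inE => /andP[/embP[f1 fi] st].
have thI : {in D &, injective th}.
  move=> f g /DP[f1 fi _] /DP[g1 gi _] [E0 EN /ffunP Er].
  have EA x : x \in A -> f x = g x by move=> xA; have := Er x; rewrite !ffunE xA.
  apply/ffunP => x; have [xPA|xPA] := boolP (x \in PA); last by rewrite f1 ?g1 ?EA.
  have [xA|xA] := boolP (x \in A); first exact: EA.
  have /(trunkP Gt sp)[i iN xE] : x \in P by move: xPA; rewrite inE (negPf xA) orbF.
  by rewrite xE; apply: (trunk_isom_eq fi gi PS).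
rewrite -(card_in_imset thI) /nmaps -cardsX; apply: eq_card => [[[a b] h]].
apply/imsetP/setXP => [[f fD [-> -> ->]]|[]].
  have [f1 fi st] := DP f fD; split; first by rewrite inE.
  have fc : f c = u (t + l) by rewrite cE (straight_isom fi PS st).
  apply/(@omapsP X (lobj Kt l M u t)); split=> /=.
  - by move=> x xA; rewrite ffunE (negPf xA) fc.
  - by move=> x y xA yA; rewrite !ffunE xA yA fi // (subsetP AS).
  - by rewrite ffunE cA.
  - by rewrite ffunE cA.
  move=> x; rewrite ffunE; case: ifP => xA; last by rewrite fc letter_root.
  by apply: (straight_letter fi PS st tM' (subsetP AS x xA) (subsetP AL x xA)).
rewrite inE => st /(@omapsP X (lobj Kt l M u t))[/= h1 hi hc _ hS].
have [u' [spu' u0 uN uE]] := straight_spine Kt spu M0 st.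
(* The map is glued from [h] and the longest path [u'] with ends [a] and [b], which agree at the
   root. *)
pose f : {ffun G -> K} := [ffun x => if x \in A then h x else
  if x \in P then u' (dist (w 0) x) else u (t + l)].
have fA x : x \in A -> f x = h x by move=> xA; rewrite ffunE xA.
have fw i : i <= N -> f (w i) = u' i.
  move=> iN; rewrite ffunE; case: ifP => [/(wA i iN) ->|_].
    by rewrite -cE hc uE.
  by rewrite wP // sp.1 //; congr u'; lia.
have fc : f c = u (t + l) by rewrite fA.
have hu' x : x \in A -> h x \in letter l M u' t.
  move=> xA; have hL : h x \in letter l M u t by apply: hS.
  have [_ pl cx] := letter_coord spu tM' hL.
  by apply/(letterP spu' _ tM'); exists (dist (h x) (u (t + l))); split=> // j jM; rewrite uE // cx.
have AP x i : x \in A -> i <= N -> dist (h x) (u' i) = dist x (w i).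
  move=> xA iN; rewrite (letter_trunk_dist Kt spu' tM iN (hu' x xA)).
  rewrite (letter_trunk_dist Gt sp tM iN (subsetP AL x xA)) uE //.
  by rewrite -hc -cE hi.
exists f; last first.
  congr (_, _, _); [by rewrite fw ?u0|by rewrite fw ?uN|].
  by apply/ffunP => x; rewrite ffunE fc; case: ifP => [/fA //|/negbT/h1].
rewrite inE; apply/andP; split; last by rewrite !fw // u0 uN.
apply/embP; split=> [x|x y].
  by rewrite fc in_setU negb_or ffunE => /andP[/negPf-> /negPf->].
rewrite !in_setU => /orP[/(trunkP Gt sp)[i iN ->]|xA] /orP[/(trunkP Gt sp)[j jN ->]|yA].
- by rewrite !fw // spu'.1 // sp.1.
- by rewrite fw // (fA y) // (dC Kt) AP // (dC Gt).
- by rewrite fw // (fA x) // AP.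
- by rewrite !fA // hi.
Qed.
End Count.
End Embeddings.

(** The image of the path runs in exactly one of two directions; reversing the spine of the source
    makes backward copies straight and moves the letter to [M - t]. *)
Lemma count_emb (G K : sgraph) (l M : nat) (w : nat -> G) (u : nat -> K) (Gt : is_tree G)
    (Kt : is_tree K) (t : nat) (c : G) (A : {set G}) (cA : c \in A) :
    spine l M w -> spine l M u -> 0 < t < M -> c = w (t + l) -> A \subset letter l M w t ->
  #|emb K (trunk l M w :|: A) c| = #|[set p | straight l M u p]| *
    (nmaps (Obj Gt cA cA) (lobj Kt l M u t) + nmaps (Obj Gt cA cA) (lobj Kt l M u (M - t))).
Proof.
move=> sp spu tM cE AL; have M0 : 0 < M by lia.
have spr := spine_rev sp; set w' := fun i => w (M + l + l - i) in spr.
have tr : 0 < M - t < M by lia.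
have cE' : c = w' (M - t + l) by rewrite /w' cE; congr w; lia.
have AL' : A \subset letter l M w' (M - t).
  by rewrite /w' letter_rev; [have -> : M - (M - t) = t by lia|lia].
have c1 := count_straight Gt Kt sp spu M0 cA tM cE AL.
have c2 := count_straight Gt Kt spr spu M0 cA tr cE' AL'.
rewrite mulnDr -c1 -c2 /w' (trunk_rev l M w Gt) subn0 subnn.
set D1 := [set f in _ | _]; set D2 := [set f in _ | _].
have D12 : D1 :&: D2 = set0.
  apply/setP => f; rewrite in_setI in_set0; apply/negP => /andP[].
  rewrite /D1 /D2 inE => /andP[_ s1]; rewrite inE => /andP[_ s2].
  have [[_ _ x1] _] := straight_coord spu s1; have [_ [_ _ x2]] := straight_coord spu s2.
  by have := x1 0 isT; rewrite x2 //; lia.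
rewrite -cardsUI D12 cards0 addn0; apply: eq_card => f; rewrite in_setU.
apply/idP/orP => [fE|[]]; last 2 first.
- by rewrite inE => /andP[].
- by rewrite inE => /andP[].
have [_ fi] := elimT (embP _ _ _) fE.
have [st|st] := isom_trunk Gt Kt sp spu M0 fi (subsetUl _ _).
  by left; rewrite inE fE.
by right; rewrite inE fE.
Qed.

Lemma nmaps_single (G : sgraph) (Gt : is_tree G) (c : G) (cA : c \in [set c]) (Y : obj) :
  oa Y = ob Y -> nmaps (Obj Gt cA cA) Y = 1.
Proof.
move=> ab; apply/eqP/cards1P; exists [ffun=> oa Y]; apply/setP => f; rewrite in_set1.
apply/(@omapsP (Obj Gt cA cA) Y)/eqP => /= [[f1 _ fa _ _]|->].
  apply/ffunP => x; rewrite ffunE; have [/set1P->//|] := boolP (x \in [set c]); exact: f1.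
split=> [x _|x y /set1P-> /set1P->|||x]; rewrite !ffunE ?distxx //; exact: oaS.
Qed.

(** * Sizes of letters *)

Section Excess.
Variables (K : sgraph) (l M : nat) (u : nat -> K).
Hypotheses (Kt : is_tree K) (sp : spine l M u).
Local Notation P := (trunk l M u).
Local Notation L i := (letter l M u i).
Local Notation N := (M + l + l).

Let w (i : 'I_N.+1) : K := u i.
Let wI : injective w.
Proof.
move=> i j E; have iM := ltn_ord i; have jM := ltn_ord j; apply: val_inj => /=.
by have := sp.1 i j; rewrite -/(w i) -/(w j) E distxx; lia.
Qed.
Let wP : w @: setT = P.
Proof.
apply/setP => x; apply/imsetP/(trunkP Kt sp) => [[i _ ->]|[i iN ->]].
  by exists i => //; have := ltn_ord i.
have iN1 : i < N.+1 by [].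
by exists (Ordinal iN1).
Qed.

Lemma card_trunk_eq : #|P| = N.+1.
Proof. by rewrite -wP card_imset // cardsT card_ord. Qed.

Lemma card_letter_trunk i : i <= M -> #|L i :&: P| = #|[set j : 'I_N.+1 | minn M (j - l) == i]|.
Proof.
move=> iM; rewrite -(card_imset _ wI); apply: eq_card => x; rewrite in_setI; apply/andP/imsetP.
  case=> xL; rewrite -{1}wP => /imsetP[j _ xj]; exists j => //; rewrite inE.
  have jN : j <= N by rewrite -ltnS ltn_ord.
  by rewrite -(trunk_letter sp jN iM) -[u j]/(w j) -xj.
case=> j; rewrite inE => jE ->; have jN : j <= N by rewrite -ltnS ltn_ord.
by rewrite -wP imset_f // /w (trunk_letter sp jN iM).
Qed.

Lemma card_letter_trunk_rev i : i <= M -> #|L i :&: P| = #|L (M - i) :&: P|.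
Proof.
move=> iM; rewrite !card_letter_trunk ?leq_subr // -(card_imset _ rev_ord_inj).
apply: eq_card => j; rewrite !inE; apply/imsetP/idP => [[h]|jE].
  by rewrite inE => hE -> /=; have := ltn_ord h; lia.
by exists (rev_ord j); rewrite ?rev_ordK // inE /=; have := ltn_ord j; lia.
Qed.

Lemma letter_trunk_inner i : 0 < i < M -> L i :&: P = [set u (i + l)].
Proof.
move=> iM; have iM' : i <= M by lia.
apply/setP => x; rewrite in_setI in_set1; apply/andP/eqP => [[xL /(trunkP Kt sp)[j jN xj]]|->].
  by move: xL; rewrite xj (trunk_letter sp) // => jE; congr u; lia.
split; first exact: letter_root.
by apply/(trunkP Kt sp); exists (i + l) => //; lia.
Qed.

Lemma card_letter i : #|L i| = #|L i :\: P| + #|L i :&: P|.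
Proof. by rewrite -(cardsID P) addnC. Qed.

Lemma card_letter_inner i : 0 < i < M -> #|L i| = #|L i :\: P|.+1.
Proof. by move=> iM; rewrite card_letter letter_trunk_inner // cards1 addn1. Qed.

Lemma sum_excess (s : seq nat) : uniq s -> all (fun i => i <= M) s ->
  \sum_(i <- s) #|L i :\: P| + N.+1 <= #|K|.
Proof.
move=> us sM; rewrite -card_trunk_eq -(cardsC P) addnC leq_add2l.
under eq_bigr => i _ do rewrite -sum1_card big_mkcond.
rewrite exchange_big -sum1_card [X in _ <= X]big_mkcond /=; apply: leq_sum => x _.
rewrite in_setC; have [xP|xP] := boolP (x \in P).
  by rewrite big1 // => i _; rewrite inE xP.
have [i0 i0M xi0] := letter_exists sp x.
apply: (@leq_trans (\sum_(i <- s) (i == i0))); last first.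
  by rewrite -(count_sum s (pred1 i0)) count_uniq_mem //; case: (_ \in _).
rewrite big_seq [X in _ <= X]big_seq; apply: leq_sum => i /(allP sM) iM.
rewrite inE xP /=; case: ifP => // xi.
by rewrite (letter_unique sp iM i0M xi xi0) eqxx.
Qed.

(** Shows that an oversized letter has no rival: if [#|K| = k + l] and [#|L i| + N > k], any other
    inner letter has at most [l] vertices. *)
Lemma two_letters i j : 0 < i < M -> 0 < j < M -> i != j -> #|L i| + #|L j| + N <= #|K|.+1.
Proof.
move=> iM jM ij; have := @sum_excess [:: i; j]; rewrite /= inE ij !big_cons big_nil.
by rewrite !card_letter_inner // => /(_ isT); lia.
Qed.

Lemma one_letter i : 0 < i < M -> #|L i| + N <= #|K|.
Proof.
move=> iM; have := @sum_excess [:: i]; rewrite /= !big_cons big_nil.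
by rewrite !card_letter_inner // => /(_ isT); lia.
Qed.
End Excess.

(** The order of quantifiers matters: one direction of the path serves all letters
    simultaneously. *)
Lemma isom_letters (G K : sgraph) (l M : nat) (w : nat -> G) (u : nat -> K) (Gt : is_tree G)
    (Kt : is_tree K) (S : {set G}) (f : G -> K) :
    spine l M w -> spine l M u -> 0 < M ->
    {in S &, forall x y, dist (f x) (f y) = dist x y} -> trunk l M w \subset S ->
  (forall i (A : {set G}) c (cA : c \in A), i <= M -> c = w (i + l) -> A \subset S ->
     A \subset letter l M w i -> 0 < nmaps (Obj Gt cA cA) (lobj Kt l M u i)) \/
  (forall i (A : {set G}) c (cA : c \in A), i <= M -> c = w (i + l) -> A \subset S ->
     A \subset letter l M w i -> 0 < nmaps (Obj Gt cA cA) (lobj Kt l M u (M - i))).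
Proof.
move=> sp spu M0 fi PS; have [st|st] := isom_trunk Gt Kt sp spu M0 fi PS; [left|right].
  by move=> i A c cA iM cE AS AL; apply: (straight_nmaps Gt Kt sp spu M0 cA fi PS st).
move=> i A c cA iM cE AS AL; have spr := spine_rev sp.
have iM' : M - i <= M by lia.
apply: (straight_nmaps (w := fun j => w (M + l + l - j)) Gt Kt spr spu M0 cA (i := M - i) fi) => //.
- by rewrite trunk_rev.
- by rewrite subn0 subnn.
- by rewrite letter_rev //; have -> : M - (M - i) = i by lia.
by rewrite cE; congr w; lia.
Qed.

Section Match.
Variables (T H : sgraph) (k l M : nat) (w : nat -> T) (u : nat -> H).
Hypotheses (Tt : is_tree T) (Ht : is_tree H) (sp : spine l M w) (spu : spine l M u).
Hypothesis TH : forall F : sgraph, #|F| <= k -> #|homs F H| = #|homs F T|.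
Hypotheses (Tn : #|T| = k + l) (Hn : #|H| = k + l) (Ml : l + 2 <= M) (Mk : M + 3 * l + 3 <= k).
Local Notation L i := (lobj Tt l M w i).
Local Notation L' i := (lobj Ht l M u i).

(** With [A] reduced to a single root, [count_emb] counts copies of the path alone, which is twice
    the number of straight pairs. *)
Lemma card_straight_eq : #|[set p | straight l M w p]| = #|[set p | straight l M u p]|.
Proof.
have tM : 0 < 1 < M by lia.
have cA : w (1 + l) \in [set w (1 + l)] by rewrite in_set1.
have AL : [set w (1 + l)] \subset letter l M w 1 by rewrite sub1set letter_root.
have cP : w (1 + l) \in trunk l M w by apply: trunk_w => //; lia.
have S1 : trunk l M w :|: [set w (1 + l)] = trunk l M w by apply/setUidPl; rewrite sub1set.
have st : star (w (1 + l)) (trunk l M w :|: [set w (1 + l)]) by rewrite S1; apply: trunk_star.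
have Sk : #|trunk l M w :|: [set w (1 + l)]| <= k.
  by rewrite S1; have := card_trunk Tt sp; lia.
have := emb_deck Tt Ht TH Tt st Sk.
rewrite (count_emb Tt Tt cA sp sp tM erefl AL) (count_emb Tt Ht cA sp spu tM erefl AL).
by rewrite !nmaps_single // => /eqP; rewrite eqn_pmul2r // => /eqP.
Qed.

(* [G] is [T] or [H] in the applications. *)
Lemma nmaps_letters (G : sgraph) (Gt : is_tree G) (g : nat -> G) t c (A : {set G}) (cA : c \in A) :
    spine l M g -> 0 < t < M -> c = g (t + l) -> A \subset letter l M g t -> star c A ->
    #|A| + (M + l + l) <= k ->
  nmaps (Obj Gt cA cA) (L t) + nmaps (Obj Gt cA cA) (L (M - t)) =
  nmaps (Obj Gt cA cA) (L' t) + nmaps (Obj Gt cA cA) (L' (M - t)).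
Proof.
move=> spg tM cE AL stA Ak; have tM' : t <= M by lia.
have st : star c (trunk l M g :|: A).
  by rewrite cE in stA *; apply: (trunk_star_letter Gt spg tM' tM' AL stA).
have cP : c \in trunk l M g by rewrite cE; apply: trunk_w => //; lia.
have Sk : #|trunk l M g :|: A| <= k.
  have := cardsU (trunk l M g) A; have := card_trunk Gt spg.
  have : 0 < #|trunk l M g :&: A| by apply/card_gt0P; exists c; rewrite inE cP cA.
  by lia.
have := emb_deck Tt Ht TH Gt st Sk.
rewrite (count_emb Gt Tt cA spg sp tM cE AL) (count_emb Gt Ht cA spg spu tM cE AL).
rewrite card_straight_eq => /eqP; rewrite eqn_pmul2l => [/eqP //|].
by apply/card_gt0P; exists (u 0, u (M + l + l)); rewrite inE; apply: straight_ends.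
Qed.

(* A letter too large to be seen together with a whole longest path is seen
   together with a short piece of it. *)
Lemma big_letter_somewhere t : 0 < t < M ->
  exists y, 0 < y < M /\ 0 < nmaps (L t) (L' y).
Proof.
move=> tM; have tM' : t <= M by lia.
(* [Q] has radius [l.+1] around [c]: its middle segment of length 2 extends by [l] on both sides, so
   its image lies on the spine of [H]. *)
have dC := dC Tt; set c := w (t + l); pose Q := itv (w (t - 1)) (w (t + l + l + 1)).
have wQ i : t - 1 <= i <= t + l + l + 1 -> w i \in Q.
  by move=> iM; apply/itvP; rewrite !sp.1; lia.
have cQ : c \in Q by apply: wQ; lia.
pose S := letter l M w t :|: Q.
have st : star c S by apply: starU; [apply: letter_star|apply: itv_star].
have Sk : #|S| <= k.
  have := cardsU (letter l M w t) Q; have := card_itv Tt (w (t - 1)) (w (t + l + l + 1)).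
  have : 0 < #|letter l M w t :&: Q| by apply/card_gt0P; exists c; rewrite in_setI cQ letter_root.
  by have := one_letter Tt sp tM; rewrite sp.1; rewrite -/Q -/S; lia.
have [f fi] := transfer Tt Ht TH st Sk.
have QS i : t - 1 <= i <= t + l + l + 1 -> w i \in S by move=> iM; rewrite in_setU wQ ?orbT.
have aS : w (t - 1 + l) \in S by apply: QS; lia.
have bS : w (t + 1 + l) \in S by apply: QS; lia.
have cS : c \in S by apply: QS; lia.
have e : ext l 2 (f (w (t - 1 + l))) (f (w (t + 1 + l))).
  apply: (isom_ext (a' := w (t - 1)) (b' := w (t + l + l + 1)) fi aS bS); rewrite ?sp.1 ?QS //; lia.
have [e0 [eM E]] := elimT (spine_ext Ht spu _ _ (isT : 0 < 2)) e.
have e1M : e0.+1 <= M by lia.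
have fx x : x \in letter l M w t -> dist (f x) (u (e0.+1 + l)) = dist x c /\ f x \in letter l M u e0.+1.
  move=> xL; have xS : x \in S by rewrite in_setU xL.
  have t1 : t - 1 <= M by lia.
  have t2 : t + 1 <= M by lia.
  have [_ pl cx] := letter_coord sp tM' xL; rewrite -/c in cx pl.
  have d1 := cx _ t1; have d2 := cx _ t2; rewrite -(fi _ _ xS aS) in d1; rewrite -(fi _ _ xS bS) in d2.
  have [E1 E2] : dist (f x) (u (e0 + l)) = dist x c + 1 /\ dist (f x) (u (e0 + 2 + l)) = dist x c + 1.
    by case: E => -[Ea Eb]; rewrite -Ea -Eb; lia.
  have [i [p cf]] := spu.2 (f x); have [iM _ cf'] := cf.
  have e0M : e0 <= M by lia.
  have := cf' _ e0M; have := cf' _ eM; rewrite E1 E2 => q1 q2.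
  have ie : i = e0.+1 by lia.
  have pE : p = dist x c by lia.
  by rewrite cf' // pE ie; split; [lia|apply/(letterP spu _ e1M); rewrite -ie; exists p].
exists e0.+1; split; first by lia.
have fc : f c = u (e0.+1 + l).
  by apply: (d0_eq Ht); have [-> _] := fx c (letter_root _ _ _ _); rewrite distxx.
apply: (@nmaps_gt0 (L t) (L' e0.+1) f) => //=.
  by move=> x y xL yL; apply: fi; rewrite in_setU ?xL ?yL.
by move=> x /fx[].
Qed.

(** A part [A] of the letter with [k - (M + l + l)] vertices is visible along with a longest path
    and lands at [t] or [M - t]. The letter at [y] holds even more vertices, and two different
    letters of such sizes do not fit into [H]. *)
Lemma big_letter t : 0 < t < M -> k < #|letter l M w t| + (M + l + l) ->
  exists y, [/\ 0 < y < M, y = t \/ y = M - t & 0 < nmaps (L t) (L' y)].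
Proof.
move=> tM big; have [y [yM h]] := big_letter_somewhere tM; exists y; split=> //.
have tM' : t <= M by lia.
set c := w (t + l).
have sz : #|[set c]| <= k - (M + l + l) <= #|letter l M w t| by rewrite cards1; lia.
have st1 : star c [set c].
  by split=> [|x]; rewrite in_set1 // => /eqP->; rewrite eqxx.
have sub : [set c] \subset letter l M w t by rewrite sub1set letter_root.
have [A [stA _ AL Ak]] := grow st1 (letter_star Tt sp tM') sub sz.
have cA := stA.1.
have cP : c \in trunk l M w by apply: trunk_w => //; lia.
have st := trunk_star_letter Tt sp tM' tM' AL stA.
have Sk : #|trunk l M w :|: A| <= k.
  have := cardsU (trunk l M w) A; have := card_trunk Tt sp.
  have : 0 < #|trunk l M w :&: A| by apply/card_gt0P; exists c; rewrite in_setI cP cA.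
  by lia.
have [f fi] := transfer Tt Ht TH st Sk.
have := nmaps_card h => /= yt.
have other z : 0 < z < M -> 0 < nmaps (Obj Tt cA cA) (L' z) -> y = z.
  move=> zM /nmaps_card /= Az; apply/eqP; apply/negPn/negP => yz.
  by have := two_letters Ht spu yM zM yz; lia.
have M0 : 0 < M by lia.
have [hs|hs] := isom_letters Tt Ht sp spu M0 fi (subsetUl _ _).
  by left; apply: other => //; apply: hs; rewrite // subsetUr.
by right; apply: other; [lia|apply: hs; rewrite // subsetUr].
Qed.
End Match.

(** * The letters of both trees *)

(** The big letter maps into a letter of [H], which is big as well and maps back into [T]. Only one
    big letter fits into [T], so both maps are isomorphisms, and every other inner letter is too
    small to be isomorphic. *)
Lemma big_match (T H : sgraph) (k l M : nat) (w : nat -> T) (u : nat -> H) (Tt : is_tree T)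
    (Ht : is_tree H) t : spine l M w -> spine l M u ->
    (forall F : sgraph, #|F| <= k -> #|homs F H| = #|homs F T|) ->
    #|T| = k + l -> #|H| = k + l -> l + 2 <= M -> M + 3 * l + 3 <= k ->
    0 < t < M -> k < #|letter l M w t| + (M + l + l) ->
  count (oiso (lobj Tt l M w t)) [:: lobj Tt l M w t; lobj Tt l M w (M - t)] =
  count (oiso (lobj Tt l M w t)) [:: lobj Ht l M u t; lobj Ht l M u (M - t)].
Proof.
move=> sp spu TH Tn Hn Ml Mk tM big.
have HT (F : sgraph) : #|F| <= k -> #|homs F T| = #|homs F H| by move=> /TH.
have [y [yM yt h1]] := big_letter Tt Ht sp spu TH Tn Hn Ml Mk tM big.
have := nmaps_card h1 => /= le1.
have big' : k < #|letter l M u y| + (M + l + l) by lia.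
have [z [zM _ h2]] := big_letter Ht Tt spu sp HT Hn Tn Ml Mk yM big'.
have := nmaps_card h2 => /= le2.
have zt : z = t.
  apply/eqP; apply/negPn/negP => zt.
  by have := two_letters Tt sp zM tM zt; lia.
rewrite zt in h2.
have ty : oiso (lobj Tt l M w t) (lobj Ht l M u y) by rewrite oiso_nmaps h1 h2.
have small (G : sgraph) (Gt : is_tree G) (g : nat -> G) i : 0 < i < M -> spine l M g -> #|G| = k + l ->
    (exists j, [/\ 0 < j < M, j != i & k < #|letter l M g j| + (M + l + l)]) ->
    oiso (lobj Tt l M w t) (lobj Gt l M g i) = false.
  move=> iM spg Gn [j [jM ji bigj]]; apply/negP => /andP[/eqP /= E _].
  by have := two_letters Gt spg jM iM ji; lia.
have [tt|tt] := eqVneq (M - t) t.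
  have yE : y = t by case: yt => // ->.
  by rewrite yE in ty; rewrite /= tt oiso_refl ty.
have nt : t != M - t by rewrite eq_sym.
have tM' : 0 < M - t < M by lia.
have e1 := small T Tt w (M - t) tM' sp Tn; rewrite /= oiso_refl e1; last by exists t.
case: yt => yE; rewrite yE in ty yM big'; rewrite ty.
  by rewrite (small H Ht u (M - t) tM' spu Hn) //; exists t.
by rewrite (small H Ht u t tM spu Hn) //; exists (M - t).
Qed.

Section Match.
Variables (T H : sgraph) (k l M : nat) (w : nat -> T) (u : nat -> H).
Hypotheses (Tt : is_tree T) (Ht : is_tree H) (sp : spine l M w) (spu : spine l M u).
Hypothesis TH : forall F : sgraph, #|F| <= k -> #|homs F H| = #|homs F T|.
Hypotheses (Tn : #|T| = k + l) (Hn : #|H| = k + l) (Ml : l + 2 <= M) (Mk : M + 3 * l + 3 <= k).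
Local Notation L i := (lobj Tt l M w i).
Local Notation L' i := (lobj Ht l M u i).
Local Notation P := (trunk l M w).

Let HT (F : sgraph) : #|F| <= k -> #|homs F T| = #|homs F H|.
Proof. by move=> /TH. Qed.

(** [nmaps_letters] covers the letters visible beside a longest path and [big_match] the others; the
    disjunction in [triangular] serves this mix. *)
Lemma pair_match t : 0 < t < M ->
  (oiso (L t) (L' t) /\ oiso (L (M - t)) (L' (M - t))) \/ (oiso (L t) (L' (M - t)) /\ oiso (L (M - t)) (L' t)).
Proof.
move=> tM; apply: eqv_pair; apply: triangular => X XI.
have tM' : 0 < M - t < M by lia.
have tt : M - (M - t) = t by lia.
have main (G : sgraph) (Gt : is_tree G) (g : nat -> G) i : spine l M g -> 0 < i < M ->
    #|letter l M g i| + (M + l + l) <= k ->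
    \sum_(Y <- [:: L i; L (M - i)]) nmaps (lobj Gt l M g i) Y =
    \sum_(Y <- [:: L' i; L' (M - i)]) nmaps (lobj Gt l M g i) Y.
  move=> spg iM small; rewrite !big_cons !big_nil !addn0.
  have iM' : i <= M by lia.
  exact: (nmaps_letters Tt Ht sp spu TH Tn Hn Ml Mk Gt (letter_root l M g i) spg iM erefl (subxx _)
    (letter_star Gt spg iM') small).
have swap (Z : obj) : (\sum_(Y <- [:: L (M - t); L t]) nmaps Z Y = \sum_(Y <- [:: L' (M - t); L' t]) nmaps Z Y \/
      count (oiso Z) [:: L (M - t); L t] = count (oiso Z) [:: L' (M - t); L' t]) ->
    \sum_(Y <- [:: L t; L (M - t)]) nmaps Z Y = \sum_(Y <- [:: L' t; L' (M - t)]) nmaps Z Y \/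
      count (oiso Z) [:: L t; L (M - t)] = count (oiso Z) [:: L' t; L' (M - t)].
  by rewrite !big_cons !big_nil /=; lia.
case: XI => [<-|[<-|[<-|[<-|//]]]].
- have [small|big] := leqP (#|letter l M w t| + (M + l + l)) k; [left; exact: main|right].
  exact: big_match sp spu TH Tn Hn Ml Mk tM big.
- apply: swap; have [small|big] := leqP (#|letter l M w (M - t)| + (M + l + l)) k; [left|right].
    by have := main _ Tt w (M - t) sp tM' small; rewrite tt.
  by have := big_match Tt Ht sp spu TH Tn Hn Ml Mk tM' big; rewrite tt.
- have [small|big] := leqP (#|letter l M u t| + (M + l + l)) k; [left; exact: main|right].
  by apply/esym; exact: big_match spu sp HT Hn Tn Ml Mk tM big.
apply: swap; have [small|big] := leqP (#|letter l M u (M - t)| + (M + l + l)) k; [left|right].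
  by have := main _ Ht u (M - t) spu tM' small; rewrite tt.
by apply/esym; have := big_match Ht Tt spu sp HT Hn Tn Ml Mk tM' big; rewrite tt.
Qed.

Lemma letter_trunk_star i : i <= M -> star (w (i + l)) (letter l M w i :&: P).
Proof.
move=> iM; have iN : i + l <= M + l + l by lia.
have rP : w (i + l) \in P by apply: trunk_w.
split; first by rewrite in_setI rP letter_root.
move=> x; rewrite in_setI => /andP[xL /(trunkP Tt sp)[j jN xj]] nx.
rewrite xj (trunk_letter sp jN iM) in xL; have {xL} jE := eqP xL.
have nij : j != i + l by apply: contra nx => /eqP E; rewrite xj E.
have [j' [j'N j'E jj]] : exists j', [/\ j' <= M + l + l, minn M (j' - l) = i &
    (j < i + l /\ j' = j.+1) \/ (i + l < j /\ j = j'.+1)].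
  have [lt|ge] := ltnP j (i + l); first by exists j.+1; split; [lia|lia|left].
  by exists j.-1; split; [lia|lia|right; lia].
exists (w j'); split.
- by rewrite in_setI (trunk_letter sp j'N iM) j'E eqxx trunk_w.
- by rewrite -(d1 Tt) xj sp.1 //; lia.
- by rewrite xj !sp.1 //; lia.
Qed.

Lemma trunk_extra (A : {set T}) : #|P :|: A| = #|P| + #|A :\: P|.
Proof. by rewrite cardsU cardsD setIC addnBA // subset_leq_card // subsetIl. Qed.

(** [A] is a part of the larger letter with one vertex more than the mirror letter, or all of it if
    the sizes agree. It cannot map into the mirror letter: it is too large, or the map would be an
    isomorphism. *)
Lemma marker t : t <= M -> #|letter l M w (M - t)| <= #|letter l M w t| -> ~~ oiso (L t) (L (M - t)) ->
  exists (A : {set T}) (cA : w (t + l) \in A), [/\ star (w (t + l)) A, A \subset letter l M w t,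
    nmaps (Obj Tt cA cA) (L (M - t)) = 0 &
    2 * #|A :\: P| <= #|letter l M w t :\: P| + #|letter l M w (M - t) :\: P| + 1].
Proof.
move=> tM le nR; have sub : letter l M w t :&: P \subset letter l M w t by apply: subsetIl.
have c1 := card_letter l M w t; have c2 := card_letter l M w (M - t).
have cc := card_letter_trunk_rev Tt sp tM.
have sz : #|letter l M w t :&: P| <= minn #|letter l M w t| #|letter l M w (M - t)|.+1 <= #|letter l M w t|.
  by lia.
have [A [stA PA AL Ak]] := grow (letter_trunk_star tM) (letter_star Tt sp tM) sub sz.
exists A, stA.1; split=> //.
  apply/eqP; rewrite -leqn0 leqNgt; apply/negP => h; have := nmaps_card h => /= AM.
  have AE : A = letter l M w t by apply/eqP; rewrite eqEcard AL; lia.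
  move/negP: nR; apply.
  have RA : oiso (Obj Tt stA.1 stA.1) (L t) by apply: oiso_eq.
  by rewrite -(oiso_trans _ RA) /oiso h andbT /= AE; lia.
have : #|A :&: P| = #|letter l M w t :&: P|.
  apply/eqP; rewrite eqn_leq; apply/andP; split; apply: subset_leq_card; first exact: setSI.
  by rewrite subsetI PA subsetIr.
by have := cardsID P A; lia.
Qed.

(** A longest path with both markers has a copy in [H], running in one direction. Forwards it maps
    [A] into a letter isomorphic to [L (M - t)], backwards it maps [B] into one isomorphic to
    [L (M - v)]; the markers forbid both. *)
Lemma no_mixed_aux t v : t <= M -> v <= M -> uniq [:: t; M - t; v; M - v] ->
    #|letter l M w (M - t)| <= #|letter l M w t| -> #|letter l M w (M - v)| <= #|letter l M w v| ->
    oiso (L (M - t)) (L' t) -> ~~ oiso (L t) (L (M - t)) ->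
    oiso (L (M - v)) (L' (M - v)) -> ~~ oiso (L v) (L (M - v)) -> False.
Proof.
move=> tM vM un let_ lev Rt nt Rv nv.
have [A [cA [stA AL A0 A2]]] := marker tM let_ nt.
have [B [cB [stB BL B0 B2]]] := marker vM lev nv.
have al : all (fun i => i <= M) [:: t; M - t; v; M - v] by rewrite /= tM vM !leq_subr.
have := sum_excess Tt sp un al; rewrite !big_cons big_nil Tn => ex.
pose S := (P :|: A) :|: (P :|: B).
(* Off the path, [A] and [B] have together at most half of [k + l - (M + l + l).+1], plus 1; the
   bound [M + 3 * l + 3 <= k] is what makes this fit. *)
have Sk : #|S| <= k.
  have := cardsU (P :|: A) (P :|: B); have := trunk_extra A; have := trunk_extra B.
  have : #|P| <= #|(P :|: A) :&: (P :|: B)|.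
    by apply: subset_leq_card; rewrite subsetI !subsetUl.
  by have := card_trunk Tt sp; rewrite -/S; lia.
have st : star (w (t + l)) S.
  apply: starU; first exact: (trunk_star_letter Tt sp tM tM AL stA).
  exact: (trunk_star_letter Tt sp vM tM BL stB).
have [f fi] := transfer Tt Ht TH st Sk.
have PS : P \subset S by rewrite /S -setUA subsetUl.
have AS : A \subset S by apply: subset_trans (subsetUl _ _); apply: subsetUr.
have BS : B \subset S by apply: subset_trans (subsetUr _ _); apply: subsetUr.
have M0 : 0 < M by lia.
have [h|h] := isom_letters Tt Ht sp spu M0 fi PS.
  by have := h t A _ cA tM erefl AS AL; rewrite -(nmaps_oiso _ Rt) A0.
by have := h v B _ cB vM erefl BS BL; rewrite -(nmaps_oiso _ Rv) B0.
Qed.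

(** Exchanging [t] with [M - t] or [v] with [M - v] puts the larger letter of each pair first. *)
Lemma no_mixed t v : t <= M -> v <= M ->
    oiso (L t) (L' (M - t)) -> oiso (L (M - t)) (L' t) -> ~~ oiso (L t) (L' t) ->
    oiso (L v) (L' v) -> oiso (L (M - v)) (L' (M - v)) -> ~~ oiso (L v) (L' (M - v)) -> False.
Proof.
move=> tM vM Rt Rt' nt Rv Rv' nv.
have nt' : ~~ oiso (L t) (L (M - t)) by rewrite (oiso_inv _ Rt').
have nv' : ~~ oiso (L v) (L (M - v)) by rewrite (oiso_inv _ Rv').
have ntt : t != M - t by apply: contra nt' => /eqP <-; rewrite oiso_refl.
have nvv : v != M - v by apply: contra nv' => /eqP <-; rewrite oiso_refl.
have ntv : t != v by apply: contra nt => /eqP ->.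
have ntv' : t != M - v by apply: contra nt => /eqP ->.
have tt := subKn tM; have vv := subKn vM.
have [ntv2 ntv3] : M - t != v /\ M - t != M - v.
  by rewrite -{1}vv !eqn_sub2lE // ?leq_subr.
have uq (a b c d : nat) : a != b -> a != c -> a != d -> b != c -> b != d -> c != d -> uniq [:: a; b; c; d].
  by move=> *; rewrite /= !inE !negb_or; do !(apply/andP; split).
have un : uniq [:: t; M - t; v; M - v] by apply: uq.
have un1 : uniq [:: M - t; t; v; M - v] by apply: uq; rewrite // eq_sym.
have un2 : uniq [:: t; M - t; M - v; v] by apply: uq; rewrite // eq_sym.
have un3 : uniq [:: M - t; t; M - v; v] by apply: uq; rewrite // eq_sym.
have tM' := leq_subr t M; have vM' := leq_subr v M.
have nt2 : ~~ oiso (L (M - t)) (L t) by rewrite oiso_sym.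
have nv2 : ~~ oiso (L (M - v)) (L v) by rewrite oiso_sym.
have [a|/ltnW a] := leqP #|letter l M w (M - t)| #|letter l M w t|;
have [b|/ltnW b] := leqP #|letter l M w (M - v)| #|letter l M w v|.
- exact: (@no_mixed_aux t v).
- by apply: (@no_mixed_aux t (M - v)); rewrite ?vv.
- by apply: (@no_mixed_aux (M - t) v); rewrite ?tt.
- by apply: (@no_mixed_aux (M - t) (M - v)); rewrite ?tt ?vv.
Qed.

(** If some pair is matched only by a swap, [no_mixed] lets every pair be matched by a swap, and
    reversing the spine of [H] aligns all letters. *)
Lemma match_iso : oiso (L 0) (L' 0) -> oiso (L M) (L' M) -> iso H T.
Proof.
move=> R0 RM.
have pm t : t <= M -> (oiso (L t) (L' t) /\ oiso (L (M - t)) (L' (M - t))) \/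
    (oiso (L t) (L' (M - t)) /\ oiso (L (M - t)) (L' t)).
  move=> tM; have [->|t0] := posnP t; first by left; rewrite subn0.
  have [->|tM'] := eqVneq t M; first by left; rewrite subnn.
  by apply: pair_match; lia.
have TH' : #|T| = #|H| by rewrite Tn Hn.
have [/allP al|] := boolP (all (fun i => oiso (L i) (L' i)) (iota 0 M.+1)).
  by apply: (glue sp spu TH') => i iM; apply: al; rewrite mem_iota.
case/allPn => t; rewrite mem_iota add0n ltnS => /= tM nt.
have [[Rt _]|[Rt Rt']] := pm t tM; first by rewrite Rt in nt.
have spur := spine_rev spu.
apply: (@glue _ _ _ _ _ _ Tt Ht sp spur TH') => i iM.
rewrite (oiso_inv _ (lobj_rev Ht l u iM)); have [[Ri Ri']|[]//] := pm i iM.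
by apply/negPn/negP => ni; apply: (no_mixed tM iM Rt Rt' nt Ri Ri' ni).
Qed.
End Match.

(** * From the spider to the theorem *)

(** The legs are the geodesics from [c]. A vertex common to two legs would be equally far from [c]
    on both and bring their ends closer than [l.+1 + l.+1]. *)
Lemma no_tripod_spider (T : sgraph) (l : nat) : is_tree T ->
  ~ contains (spider [:: l.+1; l.+1; l.+1]) T -> no_tripod l T.
Proof.
move=> Tt nS c z1 z2 z3 c1 c2 c3 z12 z13 z23; apply: nS.
have dC := dC Tt; have dT := dT Tt.
set js := [:: l.+1; l.+1; l.+1].
pose z i := nth z1 [:: z1; z2; z3] i.
have cz i : i < 3 -> dist c (z i) = l.+1 by case: i => [|[|[|]]].
have zz i j : i < 3 -> j < 3 -> i != j -> dist (z i) (z j) = l.+1 + l.+1.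
  by case: i => [|[|[|//]]]; case: j => [|[|[|//]]] //= _ _ _; rewrite // dC.
pose g (i m : nat) := odflt c [pick x | (dist c x == m) && (dist x (z i) == l.+1 - m)].
have gP i m : i < 3 -> m <= l.+1 -> dist c (g i m) = m /\ dist (g i m) (z i) = l.+1 - m.
  move=> i3 ml; rewrite -(cz i i3) in ml; have [x [cx xz]] := point Tt ml.
  rewrite /g; case: pickP => [y /andP[/eqP ? /eqP]|/(_ x)] //.
  by rewrite cx xz cz // !eqxx.
have gd i m m' : i < 3 -> m <= m' -> m' <= l.+1 -> dist (g i m) (g i m') = m' - m.
  move=> i3 mm ml; have [a1 a2] := gP i m i3 (leq_trans mm ml); have [b1 b2] := gP i m' i3 ml.
  have I1 : g i m \in itv c (z i) by apply/itvP; rewrite a1 a2 cz //; lia.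
  have I2 : g i m' \in itv c (z i) by apply/itvP; rewrite b1 b2 cz //; lia.
  by have := geo_line Tt I1 I2; rewrite a1 b1 => /(_ mm); lia.
have nl i : i < 3 -> nth 0 js i = l.+1 by case: i => [|[|[|]]].
have bnd (i : 'I_(size js)) (m : 'I_(nth 0 js i)) : m < l.+1.
  by rewrite -(nl i (ltn_ord i)) ltn_ord.
pose f (x : spider js) : T := match x with None => c | Some p => g (tag p) (tagged p).+1 end.
have fc (p : {i : 'I_(size js) & 'I_(nth 0 js i)}) : dist c (f (Some p)) = (tagged p).+1.
  by case: p => i m /=; have [] := gP i m.+1 (ltn_ord i) (bnd i m).
pose tg (i : 'I_(size js)) (m : 'I_(nth 0 js i)) := Tagged (fun i : 'I_(size js) => 'I_(nth 0 js i)) m.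
exists f.
  move=> [[i m]|] [[j m']|] E //.
  - have mm : m = m' :> nat by have := fc (tg i m); have := fc (tg j m'); rewrite -E /=; lia.
    have [ij|ij] := eqVneq (i : nat) j.
      have ij' : i = j by apply: val_inj.
      by subst j; rewrite (val_inj mm : m = m').
    have := zz i j (ltn_ord i) (ltn_ord j) ij.
    have [_ x1] := gP i m.+1 (ltn_ord i) (bnd i m); have [_ x2] := gP j m'.+1 (ltn_ord j) (bnd j m').
    have := dT (g i m.+1) (z i) (z j); rewrite dC in x1; move: E => /= E.
    by rewrite {2}E x1 x2; lia.
  - by have := fc (tg i m); rewrite E /= distxx.
  - by have := fc (tg j m'); rewrite -E /= distxx.
have stepE x y : spider_step x y -> edge (f x) (f y).
  case: x y => [[i m]|] [[j m']|] //=; rewrite -(d1 Tt).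
    case/andP=> /eqP ij /eqP mE; subst j.
    by rewrite mE gd ?ltn_ord //; [apply/eqP; lia|rewrite -mE; apply: bnd].
  by move/eqP => mE; have [-> _] := gP j m'.+1 (ltn_ord j) (bnd j m'); rewrite mE.
by move=> x y /orP[/stepE //|/stepE]; rewrite edge_sym.
Qed.

Theorem theorem5p7 (l n r : nat) (T : sgraph)
    (hl : 1 <= l) (hn : 6 * l + 11 <= n)
    (hTn : #|T| = n) (hT : is_tree T)
    (hr : longest_path_order T r) (hrn : n - 3 * l <= r)
    (hS : ~ contains (spider [:: l.+1; l.+1; l.+1]) T) :
  reconstructible l T.
Proof.
move=> H dk; rewrite hTn in dk; set k := n - l in dk.
have nk : #|T| = k + l by rewrite hTn /k; lia.
have kT : 0 < k <= #|T| by rewrite nk /k; lia.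
have HT := deck_card kT dk.
have k5 : 5 * l + 11 <= k by rewrite /k; lia.
have Ht := tree_deck hT HT nk k5 dk.
have TH (F : sgraph) : #|F| <= k -> #|homs F H| = #|homs F T|.
  by move=> Fk; apply: (deck_homs HT _ dk); rewrite Fk; case/andP: kT.
have TH' (F : sgraph) : #|F| <= k -> #|homs F T| = #|homs F H| by move=> /TH.
have nt := no_tripod_spider hT hS.
have [M rM] : exists M, r = (M + l + l).+1 by exists (r - 1 - l - l); lia.
have dm (x y : T) : dist x y <= M + l + l.
  have [p [pp pl ps up _]] := geodesic (hT.1.2 x y).
  have := hr.2 (x :: p); rewrite /is_path /= pp rM /= ps; apply.
  by move: up => /= ->.
have [a [b ab]] : exists a b : T, dist a b = M + l + l.
  case: hr => -[[|a p] /andP[pp up] sr] _; first by rewrite rM in sr.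
  by exists a, (last a p); rewrite (path_dist hT.2 pp up); move: sr; rewrite rM /= => -[].
have [w sp] := spine_exists hT nt ab dm.
have Mn := spine_card sp.
have Hnt : no_tripod l H by apply: (no_tripod_transfer hT Ht TH' _ nt); lia.
have Mk : M + l < k by lia.
have Ml : l + 4 <= M by lia.
have [u [spu ends]] := end_letters hT Ht sp TH nk Mk Ml Hnt.
have Hn : #|H| = k + l by rewrite HT.
(* With [2 * l + 5 <= M] every position is more than [l.+2] away from one end of the spine, so
   [ends] covers all letters. *)
have [big|small] := leqP (2 * l + 5) M.
  by apply: (glue sp spu (esym HT)) => i iM; apply: ends => //; lia.
have Ml' : l + 2 <= M by lia.
(* Here [M <= 2 * l + 4], hence [M + 3 * l + 3 <= 5 * l + 7], which is below [k]. *)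
have Mk' : M + 3 * l + 3 <= k by lia.
by apply: (match_iso sp spu TH nk Hn Ml' Mk' (ends 0 isT _) (ends M (leqnn M) _)); [right|left]; lia.
Qed.
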